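(* Let $(X,d,\mu)$ be a geometrically doubling metric measure space, $1<p\le q<\infty$, $\beta\in(1,\infty)$, $\alpha\in(0,1/q)$ and $k\in(1,\infty)$. Then there exists a positive constant $C$ such that, for all $f\in\mathcal{M}_p^{q,(k)}(X)$, $$\left\|M_\alpha^{(\beta)}f\right\|_{\mathcal{M}_{\widetilde p}^{\widetilde q,(k)}(X)}\le C\|f\|_{\mathcal{M}_p^{q,(k)}(X)},$$ where $\widetilde p:=\frac{p}{1-\alpha q}$ and $\widetilde q:=\frac{q}{1-\alpha q}$.
   Context: A metric space $(X,d)$ is geometrically doubling if there is $N_0\in\mathbb{N}$ such that any given ball contains no more than $N_0$ points at (mutual) distance exceeding half its radius. A geometrically doubling metric measure space $(X,d,\mu)$ is a geometrically doubling metric space with a non-negative Radon measure $\mu$; as throughout the paper, $\mu$ is a non-trivial Borel regular measure, finite on bounded sets and positive on (non-empty) open sets. For $k\in(0,\infty)$ and $1\le p\le q<\infty$, the modified Morrey space $\mathcal{M}_p^{q,(k)}(X)$ is the set of $f\in L^p_{\mathrm{loc}}(X)$ with $$\|f\|_{\mathcal{M}_p^{q,(k)}(X)}:=\sup_{B(x,r)\subset X}[\mu(B(x,kr))]^{1/q-1/p}\left[\int_{B(x,r)}|f(y)|^p\,d\mu(y)\right]^{1/p}<\infty,$$ the supremum over all balls $B(x,r)$ with $x\in X$, $r\in(0,\infty)$. For $\alpha\in[0,1]$ and $\beta\in[1,\infty)$, the modified fractional maximal operator $M_\alpha^{(\beta)}$ is defined for $f\in L^1_{\mathrm{loc}}(X)$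 and $x\in X$ by $$M_\alpha^{(\beta)}f(x):=\sup_{r>0}[\mu(B(x,\beta r))]^{\alpha-1}\int_{B(x,r)}|f(y)|\,d\mu(y).$$ *)

(* Defs.v *)
From HB Require Import structures.
From mathcomp Require Import all_boot all_order all_algebra.
From mathcomp Require Import all_classical all_reals all_analysis measurable_realfun.

Set Implicit Arguments.
Unset Strict Implicit.
Unset Printing Implicit Defensive.
Import Order.TTheory GRing.Theory Num.Theory.
Import numFieldNormedType.Exports.

Local Open Scope classical_set_scope.
Local Open Scope ring_scope.
Local Open Scope ereal_scope.

(* [caratheodory_type] carries its sigma-algebra only over a pointed type; the
   base point is harmless, since a space with a nontrivial measure is nonempty.
   As in [metricType], [ball x r] is the open ball [[set y | mdist x y < r]]. *)
#[short(type="pointedMetricType")]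
HB.structure Definition PointedMetric (K : numDomainType) :=
  {M of Metric K M & Pointed M}.

Definition geometrically_doubling (R : realType) (X : metricType R) : Prop :=
  exists N0 : nat, forall (x : X) (r : R) (A : set X), (0 < r)%R ->
    A `<=` ball x r ->
    (forall y z, A y -> A z -> y <> z -> (r / 2 < mdist y z)%R) ->
    (A #<= `I_N0)%card.

Definition metric_bounded (R : realType) (X : metricType R) (A : set X) : Prop :=
  exists (x : X) (r : R), A `<=` ball x r.

Section metric_measure_space.
Context (R : realType) (X : pointedMetricType R).
Variable mu : {outer_measure set X -> \bar R}.

(* Measures are outer measures, as usual in analysis on metric spaces;
   measurability and integrals refer to the sigma-algebra of the
   Caratheodory-measurable sets. *)
Let U := caratheodory_type mu.

Definition caratheodory_measure : {measure set U -> \bar R} :=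
  [the measure _ _ of (mu : set U -> \bar R)].

Definition borel_regular : Prop :=
  (forall B : set X, <<s @open X >> B -> mu.-caratheodory B) /\
  (forall A : set X, exists2 B : set X,
     <<s @open X >> B & A `<=` B /\ mu B = mu A).

(* Finiteness on bounded sets contains the finiteness on compact sets required
   of a Radon measure. *)
Definition radon_metric_measure : Prop :=
  [/\ mu [set: X] != 0, borel_regular,
      forall A : set X, metric_bounded A -> mu A < +oo &
      forall A : set X, open A -> A !=set0 -> 0 < mu A].

Definition Lp_loc (p : R) (f : X -> \bar R) : Prop :=
  measurable_fun [set: U] (f : U -> \bar R) /\
  forall (x : X) (r : R), (0 < r)%R ->
    \int[caratheodory_measure]_(y in (ball x r : set U)) (`|f y| `^ p) < +oo.

Definition morrey_norm (k p q : R) (f : X -> \bar R) : \bar R :=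
  ereal_sup [set mu (ball z.1 (k * z.2)%R) `^ (q^-1 - p^-1) *
                 (\int[caratheodory_measure]_(y in (ball z.1 z.2 : set U)) (`|f y| `^ p)) `^ p^-1
            | z in [set z : X * R | (0 < z.2)%R]].

Definition morrey_space (k p q : R) : set (X -> \bar R) :=
  [set f | Lp_loc p f /\ morrey_norm k p q f < +oo].

Definition fractional_maximal (alpha beta : R) (f : X -> \bar R) (x : X) :
    \bar R :=
  ereal_sup [set mu (ball x (beta * r)%R) `^ (alpha - 1) *
                 \int[caratheodory_measure]_(y in (ball x r : set U)) `|f y|
            | r in [set r : R | (0 < r)%R]].

End metric_measure_space.

(* Main.v *)
Require Import Defs.
From HB Require Import structures.
From mathcomp Require Import all_boot all_order all_algebra.
From mathcomp Require Import all_classical all_reals all_analysis measurable_realfun.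
From mathcomp Require Import ring lra.

Set Implicit Arguments.
Unset Strict Implicit.
Unset Printing Implicit Defensive.
Import Order.TTheory GRing.Theory Num.Theory.
Import numFieldNormedType.Exports.

Local Open Scope classical_set_scope.
Local Open Scope ring_scope.

(** Write [M] for the centred maximal operator obtained from
    [fractional_maximal] at exponent 0 with dilation [b], where [1 < b <= 2]
    (a smaller dilation only makes the operator larger), and [V] for the measure
    of the dilated ball.  The theorem combines three facts.

    Hedberg's inequality ([hedberg]).  Each term of the fractional maximal
    function factors as
    [V^(alpha-1) I = (V^(1/q-1) I)^(alpha q) * (V^-1 I)^(1 - alpha q)],
    where [I] is the integral of [|f|] over the ball.  The first base is bounded
    by the Morrey norm of [f] and the second by [M f], so the fractional maximal
    function is at most a constant times [(M f)^(1 - alpha q)].  Its [pt]-th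
    power is then controlled by [(M f)^p], and since [1 - pt/qt = 1 - p/q] the
    Morrey conditions for [(p, q)] and [(pt, qt)] carry the same power of the
    volume: it remains to bound [M] on the Morrey space of [(p, q)].

    Freedom in the dilation ([morrey_bounded_dilation]).  In a doubling space a
    ball of radius [r] is covered by boundedly many balls of a small radius
    [e r]; their large dilates still lie in the [k]-dilate of the first ball.
    All dilations [k > 1] therefore define equivalent Morrey norms, and [M] may
    be bounded with the comfortable dilation 6: over the ball [B] of radius [r]
    the part of [f] inside the concentric ball of radius [3 r] is handled by the
    [L^p] bound for [M], while a ball centred in [B] that leaves it has radius
    at least [2 r], contains [B], and contributes at most a constant multiple of
    [mu(B)^(-1/q)] ([maximal_local_le], [maximal_morrey]).

    The [L^p] bound ([strong_type]).  The weak type (1,1) estimate follows from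
    a greedy selection of balls of decreasing radius, each centred outside the
    [b]-dilates of the previous ones ([greedy_selection]).  These dilates cover,
    and since [b > 1] the balls that contain a common point have comparable
    radii and well separated centres, so that doubling bounds their number
    ([selection_overlap]).  Splitting [f] at height [t / 2] and summing over
    dyadic heights, as in Marcinkiewicz interpolation, gives the [L^p] bound.

    In place of norms, the proof uses the power-free condition
    [morrey_bounded]: the integrals of [|f|^p] over balls are at most
    [D * V^(1 - p/q)]. *)

(** * Separated sets and selection of balls in a doubling space *)

Section doubling.
Context (R : realType) (X : metricType R).
Implicit Types (x y z : X) (r : R) (s t : seq X).

Definition separated (e : R) (s : seq X) :=
  {in s &, forall y z, y != z -> e <= mdist y z}.

Lemma in_ball x r y : ball x r y <-> mdist x y < r.
Proof. by rewrite ballEmdist. Qed.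

Lemma sub_ball x y r r' : mdist x y + r <= r' -> ball y r `<=` ball x r'.
Proof.
move=> h z /in_ball yz; apply/in_ball; apply: le_lt_trans (metric_triangle x y z) _.
by apply: lt_le_trans h; rewrite ltrD2l.
Qed.

Lemma size_le_card s N : uniq s -> ([set` s] #<= `I_N)%card -> (size s <= N)%N.
Proof.
move=> us /geq_card_fset_set; apply: leq_trans; apply: uniq_leq_size => // x xs.
by rewrite in_fset_set ?inE//; exact: finite_seq.
Qed.

(** Pass through [s], keeping a point exactly when it is farther than [r] from
    all the points already kept. *)
Lemma exists_net r s : 0 <= r -> exists t,
  [/\ {subset t <= s}, uniq t, {in t &, forall y z, y != z -> r < mdist y z} &
      forall y, y \in s -> exists2 z, z \in t & mdist z y <= r].
Proof.
move=> r0; elim: s => [|x s [t [ts ut sept covt]]]; first by exists [::].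
have [[z zt zx]|nocov] := pselect (exists2 z, z \in t & mdist z x <= r).
  exists t; split => // [y /ts|y]; first by rewrite inE orbC => ->.
  by rewrite inE => /predU1P[->|/covt//]; exists z.
have far z : z \in t -> r < mdist z x.
  by move=> zt; rewrite ltNge; apply/negP => zx; apply: nocov; exists z.
exists (x :: t); split => [y| |y z|y].
- by rewrite !inE => /predU1P[->|/ts ->]; rewrite ?eqxx ?orbT.
- rewrite /= ut andbT; apply/negP => /far; rewrite mdistxx; lra.
- rewrite !inE => /predU1P[->|yt] /predU1P[->|zt]; rewrite ?eqxx//.
  + by rewrite metric_sym => _; exact: far.
  + by move=> _; exact: far.
  + exact: sept.
- rewrite inE => /predU1P[->|/covt[z zt zy]].
    by exists x; rewrite ?inE ?eqxx// mdistxx.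
  by exists z; rewrite // inE zt orbT.
Qed.

Lemma size_le_cover s t N (P : X -> pred X) :
  (forall y, y \in s -> exists2 z, z \in t & P z y) ->
  (forall z, z \in t -> size [seq y <- s | P z y] <= N)%N ->
  (size s <= size t * N)%N.
Proof.
elim: t s => [|z t IH] s cov small.
  by case: s cov {small} => // y s /(_ y (mem_head _ _)) [].
rewrite -(count_predC (P z)) /= mulSn -!size_filter leq_add ?small ?mem_head//.
apply: IH => [y|w wt].
  rewrite mem_filter => /andP[Pzy ys]; have [w] := cov _ ys.
  rewrite inE => /predU1P[->|wt Pw]; last by exists w.
  by move=> Pzy'; rewrite /= Pzy' in Pzy.
apply: leq_trans (small w _); last by rewrite inE wt orbT.
rewrite -filter_predI !size_filter; apply: sub_count => y /=; by case/andP.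
Qed.

Hypothesis doublingX : geometrically_doubling X.

(** By induction on [n]: a net of mesh [r / 2] in [s] has at most [N0] points
    by the doubling property, and the part of [s] near one of them lies in a
    ball of radius [3 / 4 * r]. The factor 3 / 4 leaves room between the
    closed ball of radius [r / 2] given by the net and the open balls of the
    induction. *)
Lemma geometric_separated_size : exists N : nat, forall n x r s, 0 < r ->
  uniq s -> {in s, forall y, ball x r y} ->
  separated (2 * (3 / 4) ^+ n * r) s -> (size s <= N ^ n)%N.
Proof.
have [N HN] := doublingX; exists N; elim=> [|n IH] x r s r0 us sr seps.
  rewrite expn0; case: s us sr seps => [//|y [//|z s]] /= us sr seps.
  have [yz ys zs] : [/\ y != z, y \in [:: y, z & s] & z \in [:: y, z & s]].
    by move: us; rewrite !inE !eqxx orbT negb_or => /andP[/andP[-> _] _].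
  have /in_ball xy := sr _ ys; have /in_ball xz := sr _ zs.
  have := seps _ _ ys zs yz; have := metric_triangle y x z.
  rewrite (metric_sym y x) expr0; lra.
have r20 : 0 <= r / 2 by lra.
have [t [ts ut sept covt]] := exists_net s r20.
have tN : (size t <= N)%N.
  apply: size_le_card => //; apply: (HN x r) => //.
    by move=> y /ts; exact: sr.
  by move=> y z yt zt yz; apply: sept => //; apply/eqP.
rewrite expnS; apply: leq_trans (leq_mul tN (leqnn _)).
apply: (size_le_cover (P := fun z y => mdist z y <= r / 2)) => // z zt.
apply: (IH z (3 / 4 * r)); first lra.
- exact: filter_uniq.
- by move=> y; rewrite mem_filter => /andP[zy _]; apply/in_ball; lra.
- move=> y w; rewrite !mem_filter => /andP[_ ys] /andP[_ ws] yw.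
  by have := seps _ _ ys ws yw; rewrite exprSr !mulrA.
Qed.

Lemma separated_size (e : R) : 0 < e -> exists N : nat, forall x r s, 0 < r ->
  uniq s -> {in s, forall y, ball x r y} -> separated (e * r) s ->
  (size s <= N)%N.
Proof.
move=> e0; have [N HN] := geometric_separated_size.
have [n ne] : exists n, 2 * (3 / 4) ^+ n <= e.
  have q1 : `|3 / 4 : R| < 1 by rewrite ger0_norm; lra.
  have e20 : 0 < e / 2 by lra.
  have /cvgrPdist_lt/(_ _ e20)[n _ /(_ n (leqnn n))] := cvg_expr q1.
  rewrite sub0r normrN ger0_norm; last by rewrite exprn_ge0//; lra.
  by move=> h; exists n; rewrite mulrC -ler_pdivlMr// ltW.
exists (N ^ n)%N => x r s r0 us sr seps; apply: (HN n x r) => //.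
move=> y z ys zs yz; apply: le_trans (seps _ _ ys zs yz).
by rewrite ler_wpM2r// ltW.
Qed.

(** The bound on the size of separated lists makes greedy extension stop. *)
Lemma exists_maximal_separated x (r e : R) (S : set X) : 0 < r -> 0 < e ->
  S `<=` ball x r ->
  exists s, [/\ uniq s, {in s, forall y, S y}, separated e s &
    forall y, S y -> exists2 z, z \in s & mdist z y < e].
Proof.
move=> r0 e0 Sr; have [N HN] := separated_size (divr_gt0 e0 r0).
pose ok s := [/\ uniq s, {in s, forall y, S y} & separated e s].
pose covers s := forall y, S y -> exists2 z, z \in s & mdist z y < e.
have okN s : ok s -> (size s <= N)%N.
  move=> [us sS seps]; apply: (HN x r) => //.
    by move=> y /sS; exact: Sr.
  by rewrite divfK// gt_eqF.
have extend s : ok s -> ~ covers s -> exists y, ok (y :: s).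
  move=> [us sS seps] /existsNP[y /not_implyP[Sy nocov]]; exists y.
  have far z : z \in s -> e <= mdist z y.
    by move=> zs; rewrite leNgt; apply/negP => zy; apply: nocov; exists z.
  split => [|z|z w].
  - by rewrite /= us andbT; apply/negP => /far; rewrite mdistxx; lra.
  - by rewrite inE => /predU1P[->|/sS].
  - rewrite !inE => /predU1P[->|zs] /predU1P[->|ws]; rewrite ?eqxx//.
    + by move=> _; rewrite metric_sym; exact: far.
    + by move=> _; exact: far.
    + exact: seps.
suff : forall m s, ok s -> (N - size s <= m)%N -> exists2 s', ok s' & covers s'.
  move/(_ N [::]) => [||s' [? ? ?] ?]; rewrite ?leq_subr//.
  by exists s'; split.
elim=> [|m IH] s oks le_m; have [cov|/(extend _ oks)[y oky]] := pselect (covers s).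
- by exists s.
- have := okN _ oky; rewrite /= ltnNge -subn_eq0 -leqn0 => /negP[].
  exact: le_m.
- by exists s.
- apply: (IH (y :: s)) => //=; have := okN _ oky; rewrite /= => szN.
  by rewrite subnS -ltnS prednK// subn_gt0.
Qed.

Lemma ball_cover (e : R) : 0 < e -> exists N : nat, forall x r, 0 < r ->
  exists s, [/\ (size s <= N)%N, {in s, forall y, ball x r y} &
    ball x r `<=` [set y | exists2 z, z \in s & ball z (e * r) y]].
Proof.
move=> e0; have [N HN] := separated_size e0; exists N => x r r0.
have [s [us sr seps cov]] :=
  @exists_maximal_separated x r (e * r) (ball x r) r0 (mulr_gt0 e0 r0)
    (@subset_refl _ _).
exists s; split => //; first exact: (HN x r).
by move=> y /cov[z zs zy]; exists z => //; apply/in_ball.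
Qed.

(** The radii are treated in decreasing order. At radius [r], a maximal
    separated set is chosen among the centres not covered so far; a new centre
    thus avoids the [b]-dilates of the previous balls, whose radii are at
    least [r], so that the separation is governed by the larger of the two
    radii. Finitely many radii and bounded sets of centres keep the selection
    finite. *)
Lemma greedy_selection (b : R) (rs : seq R) (E : R -> set X) (x0 : X) (r0 : R) :
  0 < b -> 0 < r0 -> {in rs, forall r, 0 < r} ->
  {in rs, forall r, E r `<=` ball x0 r0} ->
  exists u : seq (X * R), [/\ uniq u,
    {in u, forall v, v.2 \in rs /\ E v.2 v.1},
    {in u &, forall v w, v != w -> b * Num.max v.2 w.2 <= mdist v.1 w.1} &
    {in rs, forall r y, E r y -> exists2 v, v \in u & ball v.1 (b * v.2) y}].
Proof.
move=> b0 r00 rs0 Eb.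
suff : forall l, sorted (fun r r' => r' <= r) (rev l) -> {subset l <= rs} ->
    exists u : seq (X * R), [/\ uniq u,
    {in u, forall v, v.2 \in l /\ E v.2 v.1},
    {in u &, forall v w, v != w -> b * Num.max v.2 w.2 <= mdist v.1 w.1} &
    {in l, forall r y, E r y -> exists2 v, v \in u & ball v.1 (b * v.2) y}].
  pose l := sort (fun r r' => r <= r') rs.
  have ml r : (r \in l) = (r \in rs) by rewrite mem_sort.
  case/(_ l).
  - by rewrite rev_sorted sort_le_sorted.
  - by move=> r; rewrite ml.
  move=> u [uu uE sep cov]; exists u; split => //.
  - by move=> v /uE; rewrite ml.
  - by move=> r rl; apply: cov; rewrite ml.
elim=> [|r l IH] srt sub; first by exists [::].
have lerl r' : r' \in l -> r <= r'.
  move: srt; rewrite rev_sorted /=.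
  rewrite (path_sortedE); last by move=> ? ? ?; exact: le_trans.
  by move=> /andP[/allP + _] => /[apply].
have [|r' r'l|u [uu uE sep cov]] := IH.
- by move: srt; rewrite !rev_sorted => /path_sorted.
- by apply: sub; rewrite inE r'l orbT.
have rrs : r \in rs by apply: sub; rewrite mem_head.
(* The centres for radius r that the larger balls leave uncovered. *)
pose S := [set y | E r y /\ forall v, v \in u -> ~ ball v.1 (b * v.2) y].
have Sb : S `<=` ball x0 r0 by move=> y [/(Eb _ rrs)].
have [s [us sS seps covs]] :=
  exists_maximal_separated r00 (mulr_gt0 b0 (rs0 _ rrs)) Sb.
have far v y : v \in u -> y \in s -> b * v.2 <= mdist v.1 y.
  by move=> vu /sS[_ /(_ _ vu) /in_ball /negP]; rewrite -leNgt.
have lev v : v \in u -> r <= v.2 by move=> /uE[/lerl].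
exists (u ++ [seq (y, r) | y <- s]); split => [|v|v w|r' r'l y Ey].
- rewrite cat_uniq uu map_inj_uniq ?us ?andbT/=; last by move=> ? ? [].
  apply/hasPn => _ /mapP[y ys ->]; apply/negP => /= yu.
  have := far _ _ yu ys; have := mulr_gt0 b0 (rs0 _ rrs).
  by rewrite /= mdistxx; lra.
- rewrite mem_cat => /orP[/uE[vl Ev]|/mapP[y /sS[Ey _] ->]].
    by rewrite inE vl orbT.
  by rewrite mem_head.
- rewrite !mem_cat => /orP[vu|/mapP[y ys ->]] /orP[wu|/mapP[z zs ->]] /=.
  + exact: sep.
  + by move=> _; rewrite max_l ?lev//; exact: far.
  + by move=> _; rewrite max_r ?lev// metric_sym; exact: far.
  + move=> yz; rewrite maxxx; apply: seps => //.
    by apply: contra_neq yz => ->.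
have [[v vu vy]|nocov] := pselect (exists2 v, v \in u & ball v.1 (b * v.2) y).
  by exists v; rewrite // mem_cat vu.
have {r'l} /eqP r'r : r' == r.
  move: r'l; rewrite inE => /orP[//|r'l]; case: nocov; exact: cov r'l _ Ey.
rewrite r'r in Ey; have Sy : S y.
  by split => // v vu vy; apply: nocov; exists v.
have [z zs zy] := covs _ Sy; exists (z, r); last exact/in_ball.
by rewrite mem_cat map_f ?orbT.
Qed.

(** If two selected balls of radii [r' <= r] share a point, then
    [b * r <= r + r'], so [r' >= (b - 1) * r]. All balls through [z] thus have
    radii comparable to the largest one, and their centres, which lie in the
    ball of that radius around [z], are separated proportionally to it. *)
Lemma selection_overlap (b : R) : 1 < b -> b <= 2 -> exists N : nat,
  forall u : seq (X * R), uniq u -> {in u, forall v, 0 < v.2} ->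
  {in u &, forall v w, v != w -> b * Num.max v.2 w.2 <= mdist v.1 w.1} ->
  forall z, (size [seq v <- u | (mdist v.1 z < v.2)%R] <= N)%N.
Proof.
move=> b1 b2; have bb0 : 0 < b * (b - 1) by rewrite mulr_gt0; lra.
have [N HN] := separated_size bb0; exists N => u uu u0 sep z.
set w := [seq v <- u | (mdist v.1 z < v.2)%R].
have uw : uniq w by exact: filter_uniq.
have wu v : v \in w -> v \in u by rewrite mem_filter => /andP[].
have wz v : v \in w -> mdist v.1 z < v.2 by rewrite mem_filter => /andP[].
have [->//|wn0] := eqVneq w [::].
have [m mw max] : exists2 m, m \in w & forall v, v \in w -> v.2 <= m.2.
  elim: {uw wu wz} w wn0 => // v w IH _.
  have [->|/IH[m mw max]] := eqVneq w [::].
    by exists v; rewrite ?mem_head// => v'; rewrite inE => /eqP ->.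
  have [vm|mv] := lerP v.2 m.2.
    exists m; first by rewrite inE mw orbT.
    by move=> v'; rewrite inE => /predU1P[->|/max].
  exists v; rewrite ?mem_head// => v'; rewrite inE => /predU1P[->//|/max h].
  exact: le_trans h (ltW mv).
(* Here m is the selected ball of largest radius among those that contain
   z. *)
have comparable v : v \in w -> (b - 1) * m.2 <= v.2.
  move=> vw; have [->|vm] := eqVneq v m.
    have := u0 _ (wu _ mw); nra.
  have := sep _ _ (wu _ vw) (wu _ mw) vm; rewrite max_r ?max//.
  have := metric_triangle v.1 z m.1; have := wz _ vw; have := wz _ mw.
  rewrite (metric_sym z); lra.
have m0 := u0 _ (wu _ mw).
have sepw : {in w &, forall v v', v != v' ->
    b * (b - 1) * m.2 <= mdist v.1 v'.1}.
  move=> v v' vw v'w vv'; apply: le_trans (sep _ _ (wu _ vw) (wu _ v'w) vv').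
  rewrite -mulrA ler_pM2l; last lra.
  by rewrite le_max comparable.
rewrite -(size_map fst); apply: (HN z m.2) => //.
- rewrite map_inj_in_uniq// => v v' vw v'w vv'; apply/eqP; apply/negPn/negP.
  move=> /(sepw _ _ vw v'w); rewrite vv' mdistxx.
  have := mulr_gt0 bb0 m0; lra.
- move=> _ /mapP[v vw ->]; apply/in_ball; rewrite metric_sym.
  exact: lt_le_trans (wz _ vw) (max _ vw).
- move=> _ _ /mapP[v vw ->] /mapP[v' v'w ->] vv'; apply: sepw => //.
  by apply: contra_neq vv' => ->.
Qed.

End doubling.

(** * Volumes and integrals of balls, measurability of the maximal operators *)

Section metric_measure.
Context (R : realType) (X : pointedMetricType R).
Variable mu : {outer_measure set X -> \bar R}.
Hypothesis radon : radon_metric_measure mu.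
Local Open Scope ereal_scope.

Let U := caratheodory_type mu.
Implicit Types (f g : X -> \bar R) (x y z : X) (r : R) (A B : set X).

Lemma open_ball x r : open (ball x r).
Proof.
rewrite openE => y /in_ball xy; apply/nbhs_ballP.
exists (r - mdist x y)%R; first by rewrite /= subr_gt0.
by apply: sub_ball; rewrite addrC subrK.
Qed.

Lemma measurable_open A : open A -> measurable (A : set U).
Proof.
by have [_ [+ _] _ _] := radon => h oA; apply: h; exact: sub_sigma_algebra.
Qed.

Lemma measurable_metric_ball x r : measurable (ball x r : set U).
Proof. exact/measurable_open/open_ball. Qed.

Definition vol x r : R := fine (mu (ball x r)).

Lemma mu_ball x r : mu (ball x r) = (vol x r)%:E.
Proof.
have [_ _ + _] := radon; move/(_ (ball x r)) => fin.
rewrite /vol fineK// ge0_fin_numE; last exact: outer_measure_ge0.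
by apply: fin; exists x, r.
Qed.

Lemma vol_gt0 x r : (0 < r)%R -> (0 < vol x r)%R.
Proof.
move=> r0; have [_ _ _ +] := radon; move/(_ _ (open_ball x r)).
rewrite mu_ball lte_fin; apply; exists x; exact: ballxx.
Qed.

Lemma le_vol x y r r' : ball x r `<=` ball y r' -> (vol x r <= vol y r')%R.
Proof. by move=> h; rewrite -lee_fin -!mu_ball; exact: le_outer_measure. Qed.

Definition ball_int g x r : \bar R :=
  \int[caratheodory_measure mu]_(y in (ball x r : set U)) g y.

Lemma ball_int_ge0 g x r : (forall y, 0 <= g y) -> 0 <= ball_int g x r.
Proof. by move=> g0; exact: integral_ge0. Qed.

Lemma le_ball_int_sub g x y r r' : measurable_fun [set: U] g ->
  (forall z, 0 <= g z) -> ball x r `<=` ball y r' ->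
  ball_int g x r <= ball_int g y r'.
Proof.
move=> mg g0 h; apply: ge0_subset_integral => //; try exact: measurable_metric_ball.
exact: measurable_funTS.
Qed.

Lemma le_ball_int f g x r : measurable_fun [set: U] f ->
  measurable_fun [set: U] g -> (forall z, 0 <= f z) ->
  (forall z, ball x r z -> f z <= g z) -> ball_int f x r <= ball_int g x r.
Proof.
move=> mf mg f0 fg; apply: ge0_le_integral => //; try exact: measurable_funTS.
exact: measurable_metric_ball.
Qed.

Lemma ball_int_cst x r (c : \bar R) :
  ball_int (fun=> c) x r = c * (vol x r)%:E.
Proof. by rewrite -mu_ball; apply: integral_cst; exact: measurable_metric_ball. Qed.

(** An open ball is the increasing union of the smaller concentric ones. *)
Lemma ball_int_inner g x r (a : \bar R) : measurable_fun [set: U] g ->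
  (forall z, 0 <= g z) -> (0 < r)%R -> a < ball_int g x r ->
  exists2 r' : R, (0 < r' < r)%R & a < ball_int g x r'.
Proof.
move=> mg g0 r0 ar.
pose F n : set U := ball x (r - r * n.+2%:R^-1)%R.
have F_nd : {homo F : n m / (n <= m)%N >-> (n <= m)%O}.
  move=> n k nk; apply/subsetPset/sub_ball.
  by rewrite mdistxx add0r lerD2l lerN2 ler_pM2l// lef_pV2 ?posrE// ler_nat !ltnS.
have UF : \bigcup_n F n = ball x r.
  apply/seteqP; split => y.
    move=> [n _]; apply: sub_ball.
    by rewrite mdistxx add0r gerBl mulr_ge0 ?invr_ge0 ?ltW.
  move=> /in_ball xy.
  have e0 : (0 < (r - mdist x y) / r)%R by rewrite divr_gt0// subr_gt0.
  have [n _ /(_ n (leqnn n))/= ne] := near_infty_natSinv_lt (PosNum e0).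
  exists n => //; apply/in_ball.
  have : (n.+2%:R^-1 < (r - mdist x y) / r)%R.
    by apply: le_lt_trans ne; rewrite lef_pV2 ?posrE// ler_nat.
  by rewrite ltr_pdivlMr// [X in (X < _)%R]mulrC ltrBrDl -ltrBrDr.
have cvgF : \int[caratheodory_measure mu]_(y in F n) g y @[n --> \oo] -->
    ball_int g x r.
  rewrite /ball_int -UF; apply: ge0_nondecreasing_set_cvg_integral => //.
  - by move=> n; exact: measurable_metric_ball.
  - by move=> n; exact: measurable_funTS.
apply: contrapT => nor; move: ar; apply/negP; rewrite -leNgt.
apply: cvge_le cvgF; near=> n; rewrite leNgt; apply/negP => h.
apply: nor; exists (r - r * n.+2%:R^-1)%R => //.
rewrite gtrBl mulr_gt0 ?invr_gt0// andbT subr_gt0 gtr_pMr// invf_lt1//.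
by rewrite ltr1n.
Unshelve. all: by end_near. Qed.

(** The function is lower semicontinuous: by [ball_int_inner] any smaller
    value is already exceeded on a smaller concentric ball, which stays inside
    the balls of radius [r] around nearby centres. *)
Lemma measurable_ball_int g r : measurable_fun [set: U] g ->
  (forall z, 0 <= g z) -> (0 < r)%R ->
  measurable_fun [set: U] (fun x => ball_int g x r).
Proof.
move=> mg g0 r0; apply: (measurability _ (ErealGenOInfty.measurableE R)).
move=> _ [_ [a ->] <-]; rewrite setTI; apply: measurable_open.
rewrite openE => x /=; rewrite in_itv/= andbT => ax.
have [r' /andP[r'0 r'r] ar'] := ball_int_inner mg g0 r0 ax.
apply/nbhs_ballP; exists (r - r')%R; first by rewrite /= subr_gt0.
move=> y /in_ball xy /=; rewrite in_itv/= andbT; apply: lt_le_trans ar' _.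
apply: le_ball_int_sub => //; apply: sub_ball; rewrite metric_sym; lra.
Qed.

Lemma measurable_mu_ball r : (0 < r)%R ->
  measurable_fun [set: U] (fun x => mu (ball x r)).
Proof.
move=> r0; rewrite (_ : (fun x => _) = (fun x => ball_int (cst 1) x r)).
  exact: measurable_ball_int.
by apply/funext => x; rewrite ball_int_cst mul1e mu_ball.
Qed.

Section maximal.
Variables (a b : R).
Hypotheses (a1 : (a <= 1)%R) (b0 : (0 < b)%R).

Definition maximal_term f x r :=
  mu (ball x (b * r)%R) `^ (a - 1) * ball_int (fun y => `|f y|) x r.

Lemma maximal_termE f x r : maximal_term f x r =
  (vol x (b * r) `^ (a - 1))%:E * ball_int (fun y => `|f y|) x r.
Proof. by rewrite /maximal_term mu_ball. Qed.

Lemma le_powR_vol x y r r' : (0 < r)%R -> ball x r `<=` ball y r' ->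
  (vol y r' `^ (a - 1) <= vol x r `^ (a - 1))%R.
Proof.
move=> r0 h; rewrite -(opprB 1%R a) !powRN lef_pV2 ?posrE ?powR_gt0//.
- by rewrite ge0_ler_powR ?subr_ge0 ?nnegrE ?fine_ge0 ?outer_measure_ge0// le_vol.
- by apply: lt_le_trans (le_vol h); exact: vol_gt0.
- exact: vol_gt0.
Qed.

Lemma measurable_maximal_term f r : measurable_fun [set: U] f -> (0 < r)%R ->
  measurable_fun [set: U] (fun x => maximal_term f x r).
Proof.
move=> mf r0; apply: emeasurable_funM.
  apply: (measurableT_comp (measurable_poweR _)).
  by apply: measurable_mu_ball; rewrite mulr_gt0.
by apply: measurable_ball_int => //; exact: measurableT_comp.
Qed.

(** Rational radii suffice: shrinking the radius slightly to a rational one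
    changes the integral little by [ball_int_inner], and it only increases the
    factor [mu^(a-1)] because [a <= 1]. This makes the supremum countable. *)
Lemma fractional_maximal_gtP f x (c : \bar R) : measurable_fun [set: U] f ->
  c < fractional_maximal mu a b f x <->
  exists2 q : rat, (0 < ratr q :> R)%R & c < maximal_term f x (ratr q).
Proof.
move=> mf; split=> [/ereal_sup_gt[_ [r r0 <-]]|[q q0 cq]]; last first.
  by apply: lt_le_trans cq _; apply: ereal_sup_ubound; exists (ratr q).
rewrite -/(maximal_term f x r) maximal_termE.
have v0 : (0 < vol x (b * r) `^ (a - 1))%R by rewrite powR_gt0// vol_gt0// mulr_gt0.
have f0 z : 0 <= `|f z| by [].
have mf' : measurable_fun [set: U] (fun z => `|f z|) by exact: measurableT_comp.
rewrite -lte_pdivrMl// => /(ball_int_inner mf' f0 r0)[r' /andP[r'0 r'r]].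
rewrite lte_pdivrMl// => cr'.
have [q] := rat_in_itvoo r'r; rewrite in_itv/= => /andP[r'q qr].
have q0 := lt_trans r'0 r'q.
exists q => //; apply: lt_le_trans cr' _; rewrite maximal_termE.
apply: lee_pmul; rewrite ?lee_fin ?powR_ge0 ?ball_int_ge0//.
  apply: le_powR_vol; first by rewrite mulr_gt0.
  by apply: sub_ball; rewrite mdistxx add0r ler_pM2l// ltW.
by apply: le_ball_int_sub => //; apply: sub_ball; rewrite mdistxx add0r ltW.
Qed.

Lemma measurable_fractional_maximal f : measurable_fun [set: U] f ->
  measurable_fun [set: U] (fractional_maximal mu a b f).
Proof.
move=> mf; apply: (measurability _ (ErealGenOInfty.measurableE R)).
move=> _ [_ [c ->] <-]; rewrite setTI.
rewrite (_ : _ @^-1` _ = \bigcup_(q : rat) [set x |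
    (0 < ratr q :> R)%R /\ c%:E < maximal_term f x (ratr q)]).
  apply: countable_bigcupT_measurable => // q.
  have [q0|q0] := ltP 0%R (ratr q : R).
    rewrite (_ : [set _ | _] = setT `&` [set x | c%:E < maximal_term f x (ratr q)]).
      by apply: emeasurable_fun_o_infty => //; exact: measurable_maximal_term.
    by apply/seteqP; split => x /= [].
  rewrite (_ : [set _ | _] = set0)//.
  by apply/seteqP; split => x //= [].
apply/seteqP; split => x /=; rewrite in_itv/= andbT.
  by move=> /(fractional_maximal_gtP _ _ mf)[q q0 cq]; exists q.
by move=> [q _ [q0 cq]]; apply/fractional_maximal_gtP => //; exists q.
Qed.

Lemma fractional_maximal_ge0 f x : 0 <= fractional_maximal mu a b f x.
Proof.
apply: le_trans (ereal_sup_ubound _); last by exists 1%R => //=; exact: ltr01.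
by rewrite mule_ge0 ?poweR_ge0 ?integral_ge0.
Qed.

End maximal.
End metric_measure.

(** * The weak type estimate *)

Section weak_type.
Context (R : realType) (X : pointedMetricType R).
Variable mu : {outer_measure set X -> \bar R}.
Hypothesis radon : radon_metric_measure mu.
Local Open Scope ereal_scope.

Let U := caratheodory_type mu.
Let m := caratheodory_measure mu.
Implicit Types (f g : X -> \bar R) (x y z : X) (r t : R) (A B : set X).

Lemma le_mu_cover (I : eqType) (u : seq I) (F : I -> set X) A :
  A `<=` [set x | exists2 v, v \in u & F v x] ->
  mu A <= \sum_(v <- u) mu (F v).
Proof.
elim: u A => [|v u IH] A cov.
  rewrite big_nil (_ : A = set0) ?outer_measure0//.
  by apply/seteqP; split => // x /cov[].
rewrite big_cons; apply: (@le_trans _ _ (mu (A `&` F v) + mu (A `&` ~` F v))).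
  by apply: le_outer_measureIC.
apply: leeD; first by apply: le_outer_measure => x [].
apply: IH => x [/cov[w]]; rewrite inE => /predU1P[->//|wu Fw] _; by exists w.
Qed.

Lemma sum_restrict_le (u : seq (X * R)) (N : nat) f z : 0 <= f z ->
  (size [seq v <- u | (mdist v.1 z < v.2)%R] <= N)%N ->
  \sum_(v <- u) (f \_ (ball v.1 v.2)) z <= N%:R%:E * f z.
Proof.
move=> f0 szN; apply: (@le_trans _ _
   ((size [seq v <- u | (mdist v.1 z < v.2)%R])%:R%:E * f z)); last first.
  by rewrite lee_wpmul2r// lee_fin ler_nat.
rewrite size_filter {szN}; elim: u => [|v u IH]; first by rewrite big_nil mul0e.
rewrite big_cons /= natrD EFinD ge0_muleDl ?lee_fin ?ler0n//; apply: leeD => //.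
rewrite /patch; case: ifPn => [|_].
  by rewrite inE => /in_ball ->; rewrite mul1e.
by rewrite mule_ge0// lee_fin ler0n.
Qed.

Definition rat_radii (k : nat) : seq R :=
  [seq ratr q | q <- pmap (@unpickle rat) (iota 0 k) & (0 < ratr q :> R)%R].

Lemma rat_radii_gt0 k : {in rat_radii k, forall r, (0 < r)%R}.
Proof. by move=> r /mapP[q]; rewrite mem_filter => /andP[q0 _] ->. Qed.

Lemma sub_rat_radii k l : (k <= l)%N -> {subset rat_radii k <= rat_radii l}.
Proof.
move=> kl r /mapP[q]; rewrite mem_filter => /andP[q0 qk] ->.
apply: map_f; rewrite mem_filter q0 /=; move: qk; rewrite !mem_pmap.
move=> /mapP[i]; rewrite mem_iota /= => ik e.
by apply/mapP; exists i; rewrite // mem_iota; exact: leq_trans ik kl.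
Qed.

Lemma mem_rat_radii (q : rat) : (0 < ratr q :> R)%R ->
  ratr q \in rat_radii (pickle q).+1.
Proof.
move=> q0; apply: map_f; rewrite mem_filter q0 andTb mem_pmap.
by apply/mapP; exists (pickle q); rewrite ?pickleK// mem_iota; exact: (ltnSn (pickle q)).
Qed.

Hypothesis doublingX : geometrically_doubling X.
Variable b : R.
Hypotheses (b1 : (1 < b)%R) (b2 : (b <= 2)%R).

Let b0 : (0 < b)%R. Proof. by apply: lt_trans b1. Qed.

Lemma lt_maximal_term f x r t : (0 < r)%R ->
  (t%:E < maximal_term mu 0 b f x r) =
  (t%:E * mu (ball x (b * r)) < ball_int mu (fun y => `|f y|) x r).
Proof.
move=> r0; have v0 : (0 < vol mu x (b * r))%R by rewrite vol_gt0// mulr_gt0.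
rewrite maximal_termE// sub0r powR_inv1 ?ltW// lte_pdivlMl// muleC.
by rewrite (mu_ball radon).
Qed.

(** The part of a superlevel set of the maximal function that is seen with
    finitely many radii and centres in a bounded set, as [greedy_selection]
    requires; these sets increase to the whole superlevel set. *)
Definition superlevel (k : nat) f t : set X :=
  [set x | ball point k.+1%:R x /\
    exists2 r, r \in rat_radii k & t%:E < maximal_term mu 0 b f x r].

(** The dilated selected balls cover the superlevel set, each dilate has
    measure at most [t^-1] times the integral of [|f|] over its ball, and the
    balls overlap a bounded number of times. *)
Lemma weak_type_superlevel : exists N : nat, forall k f t,
  measurable_fun [set: U] f -> (0 < t)%R ->
  t%:E * mu (superlevel k f t) <= N%:R%:E * \int[m]_(y in [set: U]) `|f y|.
Proof.
have [N HN] := selection_overlap doublingX b1 b2.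
exists N => k f t mf t0.
pose E r := [set x : X | ball (point : X) k.+1%:R x /\
  t%:E < maximal_term mu 0 b f x r].
have k0 : (0 < k.+1%:R :> R)%R by rewrite ltr0n.
have [u [uu uE sep cov]] := @greedy_selection _ _ doublingX b (rat_radii k) E
  point k.+1%:R b0 k0 (@rat_radii_gt0 k) (fun r _ x => @proj1 _ _).
have u0 v : v \in u -> (0 < v.2)%R by move=> /uE[/rat_radii_gt0].
have mabs : measurable_fun [set: U] (fun y => `|f y|) by exact: measurableT_comp.
apply: (@le_trans _ _ (t%:E * \sum_(v <- u) mu (ball v.1 (b * v.2)))).
  rewrite lee_pmul2l//; apply: le_mu_cover => x [xk [r rk tx]].
  exact: (cov r rk x (conj xk tx)).
rewrite ge0_sume_distrr; last by move=> *; exact: outer_measure_ge0.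
apply: (@le_trans _ _ (\sum_(v <- u) \int[m]_(y in [set: U])
    (((fun y => `|f y|) : U -> \bar R) \_ (ball v.1 v.2 : set U)) y)).
  rewrite big_seq [leRHS]big_seq; apply: lee_sum => v vu.
  have [_ [_]] := uE _ vu; rewrite lt_maximal_term ?u0// => /ltW/le_trans; apply.
  by rewrite /ball_int integral_mkcond.
have mres (v : X * R) : measurable_fun [set: U]
    (((fun y => `|f y|) : U -> \bar R) \_ (ball v.1 v.2 : set U)).
  apply/(measurable_restrictT _ (measurable_metric_ball radon v.1 v.2)).
  exact: measurable_funTS.
have res0 (v : X * R) x :
    0 <= (((fun y => `|f y|) : U -> \bar R) \_ (ball v.1 v.2 : set U)) x.
  by rewrite /patch; case: ifP.
rewrite -ge0_integral_sum// -ge0_integralZl_EFin//.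
apply: ge0_le_integral => //.
- by move=> x _; exact: sume_ge0.
- exact: emeasurable_sum.
- exact: measurable_funeM.
- by move=> x _; apply: sum_restrict_le => //; exact: HN.
Qed.

Lemma measurable_superlevel k f t : measurable_fun [set: U] f ->
  measurable (superlevel k f t : set U).
Proof.
move=> mf; rewrite (_ : superlevel k f t = ball (point : X) k.+1%:R `&`
    \bigcup_(r in [set` rat_radii k])
      (setT `&` [set x | t%:E < maximal_term mu 0 b f x r])).
  apply: measurableI; first exact: measurable_metric_ball.
  apply: fin_bigcup_measurable; first exact: finite_seq.
  move=> r /= rk; apply: emeasurable_fun_o_infty => //.
  by apply: measurable_maximal_term => //; exact: rat_radii_gt0 rk.
apply/seteqP; split => x [xk].
  by move=> [r rk tx]; split => //; exists r.
by move=> [r rk [_ tx]]; split => //; exists r.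
Qed.

Lemma bigcup_superlevel f t : measurable_fun [set: U] f ->
  \bigcup_k superlevel k f t = [set x | t%:E < fractional_maximal mu 0 b f x].
Proof.
move=> mf; apply/seteqP; split => x /=.
  move=> [k _ [_ [r rk tx]]]; apply: lt_le_trans tx _.
  apply: ereal_sup_ubound; exists r => //; exact: rat_radii_gt0 rk.
move=> /(fractional_maximal_gtP radon ler01 b0 _ _ mf)[q q0 tx].
pose n := Num.truncn (mdist (point : X) x).
exists (maxn (pickle q).+1 n) => //; split; last first.
  exists (ratr q) => //.
  by apply: sub_rat_radii (mem_rat_radii q0); exact: leq_maxl.
apply/in_ball; apply: lt_le_trans (truncnS_gt _) _.
by rewrite ler_nat ltnS leq_maxr.
Qed.

Lemma weak_type : exists N : nat, forall f t,
  measurable_fun [set: U] f -> (0 < t)%R ->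
  t%:E * mu [set x | t%:E < fractional_maximal mu 0 b f x] <=
    N%:R%:E * \int[m]_(y in [set: U]) `|f y|.
Proof.
have [N HN] := weak_type_superlevel; exists N => f t mf t0.
rewrite -bigcup_superlevel// muleC -lee_pdivlMr//.
have nd : {homo (fun k => superlevel k f t : set U) : k l / (k <= l)%N >->
    (k <= l)%O}.
  move=> k l kl; apply/subsetPset => x [xk [r rk tx]]; split.
    by apply: sub_ball xk; rewrite mdistxx add0r ler_nat ltnS.
  by exists r => //; exact: sub_rat_radii rk.
have mS k := measurable_superlevel k t mf.
have := @nondecreasing_cvg_mu _ _ _ m _ mS (bigcupT_measurable _ mS) nd.
apply: cvge_le; near=> k.
by rewrite lee_pdivlMr// muleC HN.
Unshelve. all: by end_near. Qed.

(** The part of [f] below the height [t / 2] contributes at most [t / 2] to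
    the maximal function, since the mean is taken against the larger dilated
    ball; the weak type estimate applies to the rest. *)
Lemma weak_type_truncated : exists N : nat, forall f t,
  measurable_fun [set: U] f -> (0 < t)%R ->
  t%:E * mu [set x | t%:E < fractional_maximal mu 0 b f x] <=
    N%:R%:E * \int[m]_(y in [set y : U | (t / 2)%:E < `|f y|]) `|f y|.
Proof.
have [N HN] := weak_type; exists (2 * N)%N => f t mf t0.
have t20 : (0 < t / 2)%R by rewrite divr_gt0.
have mabs : measurable_fun [set: U] (fun y => `|f y|) by exact: measurableT_comp.
pose L : set U := [set y | (t / 2)%:E < `|f y|].
have mL : measurable L.
  by rewrite -(setTI L); exact: emeasurable_fun_o_infty.
pose g : X -> \bar R := (f : U -> \bar R) \_ L.
have mg : measurable_fun [set: U] g.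
  by apply/(measurable_restrictT _ mL); exact: measurable_funTS.
have mgabs : measurable_fun [set: U] (fun y => `|g y|) by exact: measurableT_comp.
have fg y : `|f y| <= `|g y| + (t / 2)%:E.
  rewrite /g /patch; case: ifPn; first by move=> _; rewrite leeDl// lee_fin ltW.
  by rewrite notin_setE /L /= => /negP; rewrite -leNgt normr0 add0e.
have sub : [set x | t%:E < fractional_maximal mu 0 b f x] `<=`
    [set x | (t / 2)%:E < fractional_maximal mu 0 b g x].
  move=> x /= /ereal_sup_gt[_ [r r0 <-]]; rewrite -/(maximal_term mu 0 b f x r).
  rewrite lt_maximal_term// => h.
  apply: (@lt_le_trans _ _ (maximal_term mu 0 b g x r)); last first.
    by apply: ereal_sup_ubound; exists r.
  rewrite lt_maximal_term//.
  have : t%:E * mu (ball x (b * r)) <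
      ball_int mu (fun y => `|g y|) x r + (t / 2)%:E * mu (ball x (b * r)).
    apply: lt_le_trans h _; apply: (@le_trans _ _
        (ball_int mu (fun y => `|g y| + (t / 2)%:E) x r)).
      by apply: le_ball_int => //; exact: emeasurable_funD.
    rewrite /ball_int ge0_integralD//; last 3 first.
    - exact: measurable_metric_ball.
    - exact: measurable_funTS.
    - by move=> *; rewrite lee_fin ltW.
    apply: leeD => //.
    rewrite -/(ball_int mu (fun=> (t / 2)%:E) x r) (ball_int_cst radon).
    rewrite (mu_ball radon) lee_pmul2l// lee_fin; apply: le_vol => //.
    by apply: sub_ball; rewrite mdistxx add0r ler_peMl// ltW.
  rewrite (mu_ball radon) -lteBlDr// -!EFinM -EFinB.
  by rewrite (_ : (t * _ - _) = t / 2 * vol mu x (b * r))%R//; field.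
apply: (@le_trans _ _ (2%:E * ((t / 2)%:E *
    mu [set x | (t / 2)%:E < fractional_maximal mu 0 b g x]))).
  rewrite muleA -EFinM (_ : 2 * (t / 2) = t)%R; last by field.
  by rewrite lee_pmul2l//; exact: le_outer_measure.
rewrite natrM [X in _ <= X * _]EFinM -muleA lee_pmul2l//.
apply: le_trans (HN _ _ mg t20) _.
rewrite lee_wpmul2l ?lee_fin ?ler0n// [leRHS]integral_mkcond.
rewrite le_eqVlt; apply/orP; left; apply/eqP; apply: eq_integral => y _.
by rewrite /g /patch; case: ifP => // _; rewrite abse0.
Qed.

End weak_type.

(** * Dyadic layers *)

Section dyadic.
Context (R : realType).
Variables (p eta : R).
Hypotheses (p1 : 1 < p) (eta0 : 0 < eta).

Let level n : R := eta * 2 ^+ n.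

Lemma level_gt0 n : 0 < level n.
Proof. by rewrite mulr_gt0// exprn_gt0. Qed.

Lemma levelS n : level n.+1 = 2 * level n.
Proof. by rewrite /level exprS mulrCA. Qed.

Lemma level_unbounded (A : R) : exists n, A <= level n.
Proof.
exists (Num.truncn (A / eta)).+1; rewrite [leRHS]mulrC -ler_pdivrMr//.
apply: le_trans (ltW (truncnS_gt _)) _.
by rewrite -(natrX _ 2) ler_nat ltnW// ltn_expl.
Qed.

Lemma dyadic_level (A : R) : eta < A ->
  exists n, level n < A /\ A <= level n.+1.
Proof.
move=> etaA; have exA := level_unbounded A.
case: (ex_minnP exA) => -[|n] An min.
  by move: An; rewrite /level expr0 mulr1 leNgt etaA.
exists n; split => //; rewrite ltNge; apply/negP => /min.
by rewrite ltnn.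
Qed.

Definition dyadic_const : R :=
  2 `^ p * (2 `^ (p - 1) / (2 `^ (p - 1) - 1)) * 2 `^ (p - 1).

Let rho : R := 2 `^ (p - 1).

Lemma rho_gt1 : 1 < rho.
Proof.
have <- : 1 `^ (p - 1) = 1 :> R by rewrite powR1.
by rewrite /rho gt0_ltr_powR ?subr_gt0 ?nnegrE ?ltr1n.
Qed.

Lemma dyadic_const_gt0 : 0 < dyadic_const.
Proof.
have := rho_gt1; rewrite -subr_gt0 => rho1.
by rewrite /dyadic_const !mulr_gt0 ?invr_gt0 ?powR_gt0.
Qed.

(** The summands grow geometrically with ratio [rho > 1], so that the sum is
    dominated by the last level below the cut. *)
Lemma sum_level_cut (w : R) K : 0 <= w ->
  \sum_(n < K) level n `^ (p - 1) * (level n / 2 < w)%R%:R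
    <= rho / (rho - 1) * (2 * w) `^ (p - 1).
Proof.
move=> w0; have rho1 := rho_gt1; have rho10 : 0 < rho - 1 by rewrite subr_gt0.
have c0 : 0 <= rho / (rho - 1) by rewrite divr_ge0 ?powR_ge0// ltW.
have stepl n : level n.+1 `^ (p - 1) = rho * level n `^ (p - 1).
  by rewrite levelS powRM// ltW// level_gt0.
have geom n : \sum_(i < n.+1) level i `^ (p - 1) <=
    rho / (rho - 1) * level n `^ (p - 1).
  elim: n => [|n IH].
    rewrite big_ord1 ler_peMl ?powR_ge0// ler_pdivlMr//; lra.
  rewrite big_ord_recr/= stepl; apply: le_trans (lerD IH (lexx _)) _.
  rewrite le_eqVlt; apply/orP; left; apply/eqP; field.
  by rewrite gt_eqF.
elim: K => [|K IH]; first by rewrite big_ord0 mulr_ge0 ?powR_ge0.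
have [lw|lw] := ltP (level K / 2) w; last first.
  by rewrite big_ord_recr/= ltNge lw mulr0 addr0.
apply: (@le_trans _ _ (\sum_(i < K.+1) level i `^ (p - 1))).
  apply: ler_sum => i _; rewrite -[leRHS]mulr1 ler_wpM2l ?powR_ge0//.
  by case: (_ < _).
have p10 : 0 <= p - 1 by rewrite subr_ge0 ltW.
have K0 : 0 <= level K by rewrite ltW// level_gt0.
have Kw : level K <= 2 * w by move: lw; rewrite ltr_pdivrMr// mulrC => /ltW.
apply: le_trans (geom K) _; rewrite ler_wpM2l//.
by rewrite ge0_ler_powR ?nnegrE// (le_trans K0).
Qed.

Local Open Scope ereal_scope.

(** A finite value [M] above [eta] lies between two consecutive levels, and
    the term of the series for the lower one already dominates [M^p]. *)
Lemma poweR_le_dyadic (M : \bar R) : 0 <= M ->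
  M `^ p <= (eta `^ p)%:E +
    \sum_(0 <= n <oo) (level n.+1 `^ p)%:E * ((level n)%:E < M)%E%:R%:E.
Proof.
move=> M0; set S := \sum_(0 <= n <oo) _.
have term0 n : 0 <= (level n.+1 `^ p)%:E * ((level n)%:E < M)%E%:R%:E.
  by rewrite mule_ge0// lee_fin ?powR_ge0.
have p0 : (0 < p)%R by apply: lt_trans p1.
(* The bound is shown for all real A below M, which also settles M = +oo. *)
have finite_le (A : R) : (0 <= A)%R -> A%:E <= M ->
    (A `^ p)%:E <= (eta `^ p)%:E + S.
  move=> A0 AM; have [Aeta|etaA] := leP A eta.
    rewrite -[leLHS]adde0; apply: leeD.
      by rewrite lee_fin ge0_ler_powR ?nnegrE// ltW.
    exact: nneseries_ge0.
  have [n [nA An]] := dyadic_level etaA.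
  rewrite -[leLHS]add0e; apply: leeD; first by rewrite lee_fin powR_ge0.
  apply: (@le_trans _ _ (\sum_(0 <= i < n.+1)
      (level i.+1 `^ p)%:E * ((level i)%:E < M)%E%:R%:E)).
    rewrite big_nat_recr//= -[leLHS]add0e; apply: leeD; first exact: sume_ge0.
    rewrite (_ : (_ < M) = true) ?mule1; last first.
      by apply: lt_le_trans AM; rewrite lte_fin.
    rewrite lee_fin ge0_ler_powR ?nnegrE//; [exact: ltW|].
    by rewrite ltW// level_gt0.
  exact: nneseries_lim_ge.
case: M M0 {term0} @S finite_le => [A||]// A0 S finite_le.
  by rewrite poweR_EFin; apply: finite_le => //; rewrite -lee_fin.
rewrite (_ : _ + S = +oo) ?leey//; apply/eqyP => A A0'.
have := finite_le (A `^ p^-1)%R (powR_ge0 _ _) (leey _).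
by rewrite -powRrM mulVf ?gt_eqF// powRr1// ltW.
Qed.

Lemma dyadic_le_poweR (w : \bar R) : 0 <= w ->
  \sum_(0 <= n <oo) (level n.+1 `^ p / level n)%:E *
      (if (level n / 2)%:E < w then w else 0)
    <= dyadic_const%:E * w `^ p.
Proof.
have p0 : (0 < p)%R by apply: lt_trans p1.
case: w => [w||]// w0; last first.
  by rewrite poweRyr ?gt_eqF// gt0_muley ?leey// lte_fin dyadic_const_gt0.
have w0' : (0 <= w)%R by rewrite -lee_fin.
apply: lime_le.
  apply: is_cvg_nneseries => n _ _; rewrite mule_ge0 ?lee_fin//.
    by rewrite divr_ge0 ?powR_ge0// ltW// level_gt0.
  by case: ifP.
near=> K; rewrite big_mkord.
under eq_bigr => i _.
  rewrite (_ : (if _ then _ else _) = (w * (level i / 2 < w)%R%:R)%:E); last first.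
    by rewrite lte_fin; case: ifP; rewrite ?mulr1 ?mulr0.
  rewrite -EFinM (_ : (_ * (w * _))%R =
    (2 `^ p * w * (level i `^ (p - 1) * (level i / 2 < w)%R%:R))%R); last first.
    rewrite levelS powRM ?(ltW (level_gt0 i))//.
    rewrite -(@mulr_powRB1 _ (level i) p) ?(ltW (level_gt0 i))//; field.
    by rewrite gt_eqF// level_gt0.
  over.
rewrite sumEFin poweR_EFin -EFinM lee_fin -mulr_sumr.
apply: le_trans (ler_wpM2l _ (sum_level_cut K w0')) _.
  by rewrite mulr_ge0 ?powR_ge0.
rewrite /dyadic_const powRM// -(@mulr_powRB1 _ w p)// -/rho.
rewrite le_eqVlt; apply/orP; left; apply/eqP; field.
by rewrite gt_eqF// subr_gt0 rho_gt1.
Unshelve. all: by end_near. Qed.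

End dyadic.

(** * The strong type estimate *)

Section strong_type.
Context (R : realType) (X : pointedMetricType R).
Variable mu : {outer_measure set X -> \bar R}.
Hypothesis radon : radon_metric_measure mu.
Hypothesis doublingX : geometrically_doubling X.
Local Open Scope ereal_scope.

Let U := caratheodory_type mu.
Let m := caratheodory_measure mu.
Implicit Types (f g : X -> \bar R) (x y z : X) (r t : R).

Variables (b p : R).
Hypotheses (b1 : (1 < b)%R) (b2 : (b <= 2)%R) (p1 : (1 < p)%R).

Let b0 : (0 < b)%R. Proof. by apply: lt_trans b1. Qed.

(** Cutting the range of the maximal function at the levels [eta * 2^n] and
    applying [weak_type_truncated] at each of them; the heights below [eta]
    produce the error term. *)
Lemma strong_type_error : exists2 C : R, (0 < C)%R &
  forall f x (r eta : R), measurable_fun [set: U] f -> (0 < eta)%R ->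
  ball_int mu (fun y => fractional_maximal mu 0 b f y `^ p) x r <=
    (eta `^ p * vol mu x r)%:E + C%:E * \int[m]_(y in [set: U]) `|f y| `^ p.
Proof.
have [N HN] := weak_type_truncated radon doublingX b1 b2.
exists (N.+1%:R * dyadic_const p)%R.
  by rewrite mulr_gt0// dyadic_const_gt0.
move=> f x r eta mf eta0.
pose M := fractional_maximal mu 0 b f.
have M0 y : 0 <= M y by exact: fractional_maximal_ge0.
have mM : measurable_fun [set: U] M.
  exact: (measurable_fractional_maximal radon ler01 b0).
have mMp : measurable_fun [set: U] (fun y => M y `^ p).
  exact: (measurableT_comp (measurable_poweR _)).
have Mp0 y : 0 <= M y `^ p by exact: poweR_ge0.
pose t n : R := (eta * 2 ^+ n)%R.
have t0 n : (0 < t n)%R by rewrite level_gt0.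
pose A n : set U := [set y | (t n)%:E < M y].
have mA n : measurable (A n).
  by rewrite -(setTI (A n)); exact: emeasurable_fun_o_infty.
pose L n : set U := [set y | (t n / 2)%:E < `|f y|].
have mabs : measurable_fun [set: U] (fun y => `|f y|) by exact: measurableT_comp.
have mL n : measurable (L n).
  by rewrite -(setTI (L n)); exact: emeasurable_fun_o_infty.
pose c n : R := (t n.+1 `^ p)%R.
have c0 n : (0 <= c n)%R by exact: powR_ge0.
pose G n y : \bar R := (c n)%:E * (\1_(A n) y)%:E.
have G0 n y : 0 <= G n y by rewrite mule_ge0// lee_fin.
have mind n : measurable_fun [set: U] (fun y => (\1_(A n) y : R)%:E).
  by apply/measurable_EFinP; exact: measurable_indic.
have mG n : measurable_fun [set: U] (G n) by exact: measurable_funeM.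
have mball := measurable_metric_ball radon x r.
have layers : ball_int mu (fun y => M y `^ p) x r <=
    (eta `^ p * vol mu x r)%:E + \sum_(0 <= n <oo) (c n)%:E * m (A n).
  have mS : measurable_fun [set: U] (fun y => \sum_(0 <= n <oo) G n y).
    exact: (ge0_emeasurable_sum (P := xpredT)).
  have S0 y : 0 <= \sum_(0 <= n <oo) G n y by exact: nneseries_ge0.
  apply: (@le_trans _ _ (ball_int mu
      (fun y => (eta `^ p)%:E + \sum_(0 <= n <oo) G n y) x r)).
    apply: le_ball_int => //; first exact: emeasurable_funD.
    move=> y _; apply: le_trans (poweR_le_dyadic p1 eta0 (M0 y)) _.
    rewrite le_eqVlt; apply/orP; left; apply/eqP; congr (_ + _).
    apply: eq_eseriesr => n _; congr (_ * (nat_of_bool _)%:R%:E).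
    by apply/idP/idP => [h|]; rewrite ?inE// mem_set.
  rewrite /ball_int ge0_integralD//; last 2 first.
  - by move=> *; rewrite lee_fin powR_ge0.
  - exact: measurable_funTS.
  rewrite -/(ball_int mu (fun=> (eta `^ p)%:E) x r) (ball_int_cst radon).
  apply: leeD => //; rewrite integral_nneseries//; last first.
    by move=> n; exact: measurable_funTS.
  apply: lee_nneseries => [n _ _|n _]; first exact: integral_ge0.
  rewrite /G ge0_integralZl_EFin//; last exact: measurable_funTS.
  rewrite lee_wpmul2l ?lee_fin// integral_indic//.
  by apply: le_measure; rewrite ?inE//; exact: measurableI.
apply: le_trans layers _; apply: leeD => //.
pose h n y : \bar R := if (t n / 2)%:E < `|f y| then `|f y| else 0.
have h0 n y : 0 <= h n y by rewrite /h; case: ifP.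
have hE n : h n = ((fun y => `|f y|) : U -> \bar R) \_ (L n).
  apply/funext => y; rewrite /h /patch; congr (if _ then _ else _).
  by apply/idP/idP => [hy|]; rewrite ?inE// mem_set.
have mh n : measurable_fun [set: U] (h n).
  by rewrite hE; apply/(measurable_restrictT _ (mL n)); exact: measurable_funTS.
pose w n : R := (c n / t n)%R.
have w0 n : (0 <= w n)%R by rewrite divr_ge0// ltW.
have mhp : measurable_fun [set: U] (fun y => `|f y| `^ p).
  exact: (measurableT_comp (measurable_poweR _)).
have fp0 y : 0 <= `|f y| `^ p by exact: poweR_ge0.
have F0 n y : 0 <= N.+1%:R%:E * ((w n)%:E * h n y) by rewrite !mule_ge0// lee_fin.
have mF n : measurable_fun [set: U] (fun y => N.+1%:R%:E * ((w n)%:E * h n y)).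
  by do 2!apply: measurable_funeM.
apply: (@le_trans _ _ (\sum_(0 <= n <oo)
    \int[m]_(y in [set: U]) (N.+1%:R%:E * ((w n)%:E * h n y)))).
  apply: lee_nneseries => [n _ _|n _]; first by rewrite mule_ge0// lee_fin.
  rewrite ge0_integralZl_EFin//; last 2 first.
  - by move=> y _; rewrite mule_ge0// lee_fin.
  - exact: measurable_funeM.
  rewrite ge0_integralZl_EFin// hE -integral_mkcond.
  have := HN f _ mf (t0 n); rewrite -/(A n) -/(L n) => weak.
  rewrite muleCA /w EFinM -muleA lee_wpmul2l ?lee_fin// lee_pdivlMl//.
  apply: le_trans weak _; rewrite lee_wpmul2r ?integral_ge0//.
  by rewrite lee_fin ler_nat.
rewrite -integral_nneseries//.
rewrite -ge0_integralZl_EFin//; last first.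
  by rewrite mulr_ge0// ltW// dyadic_const_gt0.
apply: ge0_le_integral => //.
- by move=> y _; exact: nneseries_ge0.
- exact: (ge0_emeasurable_sum (P := xpredT)).
- exact: measurable_funeM.
- move=> y _; rewrite nneseriesZl; last by move=> n _; rewrite mule_ge0// lee_fin.
  rewrite EFinM -muleA lee_wpmul2l// ?lee_fin//.
  exact: dyadic_le_poweR.
Qed.

(** A ball has finite measure, so the error term vanishes as [eta] tends to
    0. *)
Lemma strong_type : exists2 C : R, (0 < C)%R &
  forall f x r, measurable_fun [set: U] f -> (0 < r)%R ->
  ball_int mu (fun y => fractional_maximal mu 0 b f y `^ p) x r <=
    C%:E * \int[m]_(y in [set: U]) `|f y| `^ p.
Proof.
have [C C0 HC] := strong_type_error; exists C => // f x r mf r0.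
have p0 : (0 < p)%R by apply: lt_trans p1.
have v0 := vol_gt0 radon x r0.
apply/lee_addgt0Pr => e e0.
(* This value of eta makes the error term equal to e. *)
have ev0 : (0 < (e / vol mu x r) `^ p^-1)%R by rewrite powR_gt0// divr_gt0.
apply: le_trans (HC f x r _ mf ev0) _.
rewrite -powRrM mulVf ?gt_eqF// powRr1; last by rewrite divr_ge0 ?ltW.
by rewrite divfK ?gt_eqF// addeC.
Qed.

End strong_type.

(** * Morrey conditions and the maximal operator *)

Section real_powers.
Context (R : realType).
Implicit Types (x y d r s : R).

Lemma powR_expR d r : expR d `^ r = expR (r * d).
Proof. by rewrite /powR gt_eqF ?expR_gt0// expRK. Qed.

Lemma powR_exponent_le x y r : 0 < x -> x <= y -> r <= 0 -> y `^ r <= x `^ r.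
Proof.
move=> x0 xy r0; have y0 := lt_le_trans x0 xy.
rewrite -(opprK r) (powRN y) (powRN x) lef_pV2 ?posrE ?powR_gt0//.
by rewrite ge0_ler_powR ?oppr_ge0 ?nnegrE ?(ltW x0) ?(ltW y0).
Qed.

Lemma ge0_le_poweR (w v : \bar R) r : 0 <= r -> (0 <= w)%E -> (w <= v)%E ->
  (w `^ r <= v `^ r)%E.
Proof.
move=> r0 w0 wv; apply: gt0_ler_poweR => //; rewrite in_itv/= ?leey ?andbT//.
exact: le_trans wv.
Qed.

Lemma root_le_iff (I : \bar R) (B p : R) : 0 < p -> 0 <= B -> (0 <= I)%E ->
  (I `^ p^-1 <= B%:E)%E <-> (I <= (B `^ p)%:E)%E.
Proof.
move=> p0 B0 I0; have p10 : p^-1 != 0 by rewrite gt_eqF ?invr_gt0.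
case: I I0 => [w w0||//]; last first.
  by rewrite poweRyr//; split; rewrite leye_eq => /eqP.
rewrite lee_fin in w0; rewrite poweR_EFin !lee_fin; split => h.
- have -> : w = (w `^ p^-1) `^ p by rewrite -powRrM mulVf ?gt_eqF// powRr1.
  by rewrite ge0_ler_powR ?nnegrE ?powR_ge0// ltW.
- have -> : B = (B `^ p) `^ p^-1 by rewrite -powRrM mulfV ?gt_eqF// powRr1.
  by rewrite ge0_ler_powR ?nnegrE ?powR_ge0// invr_ge0 ltW.
Qed.

End real_powers.

Section morrey.
Context (R : realType) (X : pointedMetricType R).
Variable mu : {outer_measure set X -> \bar R}.
Hypothesis radon : radon_metric_measure mu.
Hypothesis doublingX : geometrically_doubling X.
Local Open Scope ereal_scope.

Let U := caratheodory_type mu.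
Let m := caratheodory_measure mu.
Implicit Types (f g G : X -> \bar R) (x y z : X) (r t : R).

(** The [p]-th power of a Morrey bound: for [G = |f|^p] and [a = 1 - p / q] it
    says that the Morrey norm of [f] is at most [D^(1/p)], see
    [morrey_norm_leP]. The exponents [p] and [q] enter only through [a]. *)
Definition morrey_bounded (k a D : R) G := forall x r, (0 < r)%R ->
  ball_int mu G x r <= (D * vol mu x (k * r) `^ a)%:E.

Lemma vol_ge0 x r : (0 <= vol mu x r)%R.
Proof. exact/fine_ge0/outer_measure_ge0. Qed.

Lemma ball_int_cover G x r (e : R) (s : seq X) : measurable_fun [set: U] G ->
  (forall y, 0 <= G y) ->
  ball x r `<=` [set y | exists2 z, z \in s & ball z e y] ->
  ball_int mu G x r <= \sum_(z <- s) ball_int mu G z e.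
Proof.
move=> mG G0 cov.
have mres z e' : measurable_fun [set: U] ((G : U -> \bar R) \_ (ball z e' : set U)).
  apply/(measurable_restrictT _ (measurable_metric_ball radon z e')).
  exact: measurable_funTS.
have res0 z e' y : 0 <= ((G : U -> \bar R) \_ (ball z e' : set U)) y.
  by rewrite /patch; case: ifP.
rewrite /ball_int integral_mkcond; under eq_bigr do rewrite integral_mkcond.
rewrite -ge0_integral_sum//; apply: ge0_le_integral => //.
  exact: emeasurable_sum.
move=> y _; rewrite {1}/patch; case: ifPn => [|_]; last exact: sume_ge0.
rewrite inE => /cov[z zs zy]; rewrite (big_rem z zs) /=.
rewrite {1}/patch mem_set//; rewrite leeDl//; exact: sume_ge0.
Qed.

(** Cover the ball of radius [r] by balls centred in it of radius
    [(k - 1) / K * r]: their [K]-dilates have radius [(k - 1) * r], hence lie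
    in the ball of radius [k * r]. *)
Lemma morrey_bounded_dilation (k K a : R) :
  (1 < k)%R -> (0 < K)%R -> (0 <= a)%R ->
  exists N : nat, forall G (D : R), measurable_fun [set: U] G ->
    (forall y, 0 <= G y) -> (0 <= D)%R ->
    morrey_bounded K a D G -> morrey_bounded k a (N%:R * D) G.
Proof.
move=> k1 K0 a0; have e0 : (0 < (k - 1) / K)%R by rewrite divr_gt0// subr_gt0.
have [N HN] := ball_cover doublingX e0; exists N => G D mG G0 D0 bG x r r0.
have [s [sN sr cov]] := HN x r r0.
apply: le_trans (ball_int_cover mG G0 cov) _.
have k0 : (0 < k)%R by apply: lt_trans k1.
apply: (@le_trans _ _ (\sum_(z <- s) (D * vol mu x (k * r) `^ a)%:E)).
  rewrite big_seq [leRHS]big_seq; apply: lee_sum => z zs.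
  apply: le_trans (bG z _ (mulr_gt0 e0 r0)) _; rewrite lee_fin ler_wpM2l//.
  rewrite ge0_ler_powR ?nnegrE ?vol_ge0//; apply: le_vol => //; apply: sub_ball.
  have /in_ball/ltW xz := sr _ zs.
  rewrite (_ : K * _ = (k - 1) * r)%R; last by field; rewrite gt_eqF.
  lra.
rewrite sumEFin lee_fin big_const_seq count_predT iter_addr_0 -[leLHS]mulr_natl mulrA.
by rewrite ler_wpM2r ?powR_ge0// ler_wpM2r// ler_nat.
Qed.

Lemma morrey_norm_leP (k p q A : R) f : (0 < k)%R -> (0 < p)%R -> (0 < q)%R ->
  (0 <= A)%R ->
  morrey_norm mu k p q f <= A%:E <->
  morrey_bounded k (1 - p / q) (A `^ p) (fun y => `|f y| `^ p).
Proof.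
move=> k0 p0 q0 A0.
have ball_iff x r : (0 < r)%R ->
    mu (ball x (k * r)) `^ (q^-1 - p^-1) *
      (ball_int mu (fun y => `|f y| `^ p) x r) `^ p^-1 <= A%:E <->
    ball_int mu (fun y => `|f y| `^ p) x r <=
      (A `^ p * vol mu x (k * r) `^ (1 - p / q))%:E.
  move=> r0; have v0 : (0 < vol mu x (k * r))%R by rewrite vol_gt0// mulr_gt0.
  rewrite (mu_ball radon) poweR_EFin.
  have -> : (vol mu x (k * r) `^ (q^-1 - p^-1) =
      (vol mu x (k * r) `^ (p^-1 - q^-1))^-1)%R by rewrite -powRN opprB.
  rewrite lee_pdivrMl ?powR_gt0// -EFinM root_le_iff//; last 2 first.
  - by rewrite mulr_ge0// powR_ge0.
  - by apply: integral_ge0 => y _; exact: poweR_ge0.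
  rewrite powRM ?powR_ge0// -powRrM (_ : (p^-1 - q^-1) * p = 1 - p / q)%R.
    by rewrite [X in _ <= X%:E <-> _]mulrC.
  by field; rewrite !gt_eqF.
split=> [le x r r0|bd].
  apply/ball_iff => //; apply: le_trans le; apply: ereal_sup_ubound.
  by exists (x, r).
by apply: ge_ereal_sup => _ [[x r] /= r0 <-]; apply/ball_iff => //; exact: bd.
Qed.

(** Where [w > l], the factor [(w / l)^(p-1)] is at least 1. *)
Lemma young_le (p l : R) (w : \bar R) : (1 < p)%R -> (0 < l)%R -> 0 <= w ->
  w <= l%:E + (l `^ (1 - p))%:E * w `^ p.
Proof.
move=> p1 l0; have p0 : (0 < p)%R by apply: lt_trans p1.
case: w => [w||//]; last first.
  by move=> _; rewrite poweRyr ?gt_eqF// gt0_muley ?lte_fin ?powR_gt0.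
rewrite lee_fin => w0; rewrite poweR_EFin -EFinM -EFinD lee_fin.
have [wl|lw] := leP w l; first by rewrite -[leLHS]addr0 lerD ?mulr_ge0 ?powR_ge0.
have w0' := lt_trans l0 lw.
rewrite -[leLHS]add0r; apply: lerD; first exact: ltW.
have {1}-> : w = (w `^ (1 - p) * w `^ p)%R.
  by rewrite -powRD ?subrK ?powRr1// gt_eqF ?implybT.
rewrite ler_wpM2r ?powR_ge0// powR_exponent_le// ?subr_le0; exact: ltW.
Qed.

(** Hoelder's inequality up to a factor 2. The pointwise bound [young_le] is
    integrated with the [l] that balances its two terms. *)
Lemma ball_int_young (b p q D : R) f : (1 <= b)%R -> (1 < p)%R -> (0 < q)%R ->
  (0 < D)%R -> measurable_fun [set: U] f ->
  morrey_bounded b (1 - p / q) D (fun y => `|f y| `^ p) ->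
  forall x r, (0 < r)%R -> ball_int mu (fun y => `|f y|) x r <=
    (2 * D `^ p^-1 * vol mu x (b * r) `^ (1 - q^-1))%:E.
Proof.
move=> b1 p1 q0 D0 mf bf x r r0; have p0 : (0 < p)%R by apply: lt_trans p1.
have br0 : (0 < b * r)%R by rewrite mulr_gt0// (lt_le_trans _ b1).
set v := vol mu x (b * r); have v0 : (0 < v)%R by exact: vol_gt0.
pose l : R := (D `^ p^-1 * v `^ (- q^-1))%R.
have l0 : (0 < l)%R by rewrite mulr_gt0 ?powR_gt0.
have mabs : measurable_fun [set: U] (fun y => `|f y|) by exact: measurableT_comp.
have mp : measurable_fun [set: U] (fun y => `|f y| `^ p).
  exact: (measurableT_comp (measurable_poweR _)).
have p_ge0 y : 0 <= `|f y| `^ p by exact: poweR_ge0.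
have lp0 : (0 <= l `^ (1 - p))%R by exact: powR_ge0.
apply: (@le_trans _ _ (ball_int mu
    (fun y => l%:E + (l `^ (1 - p))%:E * `|f y| `^ p) x r)).
  apply: le_ball_int => //.
    by apply: emeasurable_funD => //; exact: measurable_funeM.
  by move=> y _; exact: young_le.
have mball := measurable_metric_ball radon x r.
rewrite /ball_int ge0_integralD//; first last.
- by apply: measurable_funTS; exact: measurable_funeM.
- by move=> y _; rewrite mule_ge0// lee_fin.
- by move=> y _; rewrite lee_fin ltW.
rewrite -/(ball_int mu (fun=> l%:E) x r) (ball_int_cst radon).
rewrite ge0_integralZl_EFin//; last exact: measurable_funTS.
rewrite -/(ball_int mu (fun y => `|f y| `^ p) x r).
apply: (@le_trans _ _ ((l * v)%:E + (l `^ (1 - p) * (D * v `^ (1 - p / q)))%:E)).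
  apply: leeD.
    rewrite -EFinM lee_fin ler_wpM2l ?(ltW l0)//; apply: le_vol => //; apply: sub_ball.
    by rewrite mdistxx add0r ler_peMl// ltW.
  by rewrite EFinM lee_wpmul2l ?lee_fin//; exact: bf.
rewrite -EFinD lee_fin le_eqVlt; apply/orP; left; apply/eqP.
(* Both terms are equal; in terms of exp this is linear algebra of
   exponents. *)
rewrite /l -(lnK D0) -(lnK v0); move: (ln D) (ln v) => d w.
rewrite !powR_expR -!expRD powR_expR -!expRD -mulrA -expRD mulr_natl mulr2n.
by congr (expR _ + expR _)%R; field; rewrite !gt_eqF.
Qed.

Section maximal_morrey.
Variables (b p q : R).
Hypotheses (b1 : (1 < b)%R) (b2 : (b <= 2)%R) (p1 : (1 < p)%R) (pq : (p <= q)%R).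

Let b0 : (0 < b)%R. Proof. by apply: lt_trans b1. Qed.
Let p0 : (0 < p)%R. Proof. by apply: lt_trans p1. Qed.
Let q0 : (0 < q)%R. Proof. by apply: lt_le_trans pq. Qed.

(** A ball centred at [y] of radius at most [2 * r] only sees [f] inside the
    ball of radius [3 * r] around [x]; a larger one contains the ball of
    radius [r] around [x], so that [ball_int_young] bounds its term by a power
    of the volume of the latter. *)
Lemma maximal_local_le f (D : R) x r y : (0 < D)%R -> (0 < r)%R ->
  measurable_fun [set: U] f ->
  morrey_bounded b (1 - p / q) D (fun y => `|f y| `^ p) -> ball x r y ->
  fractional_maximal mu 0 b f y <=
    maxe (fractional_maximal mu 0 b
            ((f : U -> \bar R) \_ (ball x (3 * r) : set U)) y)
         (2 * D `^ p^-1 * vol mu x r `^ (- q^-1))%:E.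
Proof.
move=> D0 r0 mf bf /in_ball xy; apply: ge_ereal_sup => _ [s /= s0 <-].
rewrite le_max; have [sr|rs] := leP s (2 * r)%R.
  apply/orP; left; apply: ereal_sup_ubound; exists s => //.
  congr (_ * _); apply: eq_integral => z; rewrite inE => yz.
  rewrite /patch mem_set//; apply: sub_ball yz; lra.
apply/orP; right.
have bs0 : (0 < b * s)%R by rewrite mulr_gt0.
rewrite -/(maximal_term mu 0 b f y s) maximal_termE//.
have v0 := vol_gt0 radon y bs0.
apply: le_trans (lee_wpmul2l _ (ball_int_young (ltW b1) p1 q0 D0 mf bf y s0)) _.
  by rewrite lee_fin powR_ge0.
rewrite -EFinM lee_fin mulrCA ler_wpM2l ?mulr_ge0 ?powR_ge0// -powRD; last first.
  by apply/implyP => _; rewrite gt_eqF.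
rewrite (_ : _ + _ = - q^-1)%R; last by ring.
rewrite powR_exponent_le ?vol_gt0// ?oppr_le0 ?invr_ge0 ?(ltW q0)//.
apply: le_vol => //; apply: sub_ball; rewrite metric_sym.
have : (s <= b * s)%R by rewrite ler_peMl// ltW.
lra.
Qed.

(** The [L^p] bound applies to the local part of [f], which lives on the ball
    of radius [3 * r] and is therefore controlled by the volume of the ball of
    radius [2 * (3 * r)]; the far part is bounded on the ball. *)
Lemma maximal_morrey : exists2 C : R, (0 < C)%R & forall f (D : R),
  (0 < D)%R -> measurable_fun [set: U] f ->
  morrey_bounded b (1 - p / q) D (fun y => `|f y| `^ p) ->
  morrey_bounded 2 (1 - p / q) D (fun y => `|f y| `^ p) ->
  morrey_bounded 6 (1 - p / q) (C * D)
    (fun y => fractional_maximal mu 0 b f y `^ p).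
Proof.
have [C C0 HC] := strong_type radon doublingX b1 b2 p1.
exists (C + 2 `^ p)%R; first by rewrite addr_gt0// powR_gt0.
move=> f D D0 mf bf bf2 x r r0.
have r30 : (0 < 3 * r)%R by rewrite mulr_gt0.
pose g : X -> \bar R := (f : U -> \bar R) \_ (ball x (3 * r) : set U).
have mg : measurable_fun [set: U] g.
  apply/(measurable_restrictT _ (measurable_metric_ball radon x (3 * r))).
  exact: measurable_funTS.
pose T : R := (2 * D `^ p^-1 * vol mu x r `^ (- q^-1))%R.
have T0 : (0 <= T)%R by rewrite !mulr_ge0 ?powR_ge0.
have M0 h y : 0 <= fractional_maximal mu 0 b h y by exact: fractional_maximal_ge0.
have mM h : measurable_fun [set: U] h ->
    measurable_fun [set: U] (fun y => fractional_maximal mu 0 b h y `^ p).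
  move=> mh; apply: (measurableT_comp (measurable_poweR _)).
  exact: (measurable_fractional_maximal radon ler01 b0).
have Mp0 h y : 0 <= fractional_maximal mu 0 b h y `^ p by exact: poweR_ge0.
have a0 : (0 <= 1 - p / q)%R by rewrite subr_ge0 ler_pdivrMr// mul1r.
apply: (@le_trans _ _ (ball_int mu
    (fun y => fractional_maximal mu 0 b g y `^ p + (T `^ p)%:E) x r)).
  apply: le_ball_int => //; [exact: mM|by apply: emeasurable_funD => //; exact: mM|].
  move=> y xy; have := maximal_local_le D0 r0 mf bf xy.
  rewrite le_max -/g -/T => /orP[h|h].
    apply: (@le_trans _ _ (fractional_maximal mu 0 b g y `^ p)).
      by apply: ge0_le_poweR => //; exact: ltW.
    by rewrite leeDl// lee_fin powR_ge0.
  apply: (@le_trans _ _ (T `^ p)%:E); last by rewrite leeDr.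
  by rewrite -poweR_EFin; apply: ge0_le_poweR => //; exact: ltW.
have mball := measurable_metric_ball radon x r.
rewrite /ball_int ge0_integralD//; first last.
- by move=> y _; rewrite lee_fin powR_ge0.
- by apply: measurable_funTS; exact: mM.
rewrite -/(ball_int mu (fun=> (T `^ p)%:E) x r) (ball_int_cst radon).
rewrite mulrDl mulrDl EFinD; apply: leeD.
  apply: le_trans (HC g x r mg r0) _.
  rewrite -mulrA EFinM lee_wpmul2l ?lee_fin ?(ltW C0)//.
  rewrite (_ : \int[m]_(y in _) _ = ball_int mu (fun y => `|f y| `^ p) x (3 * r)).
    by apply: le_trans (bf2 x _ r30) _; rewrite mulrA (_ : 2 * 3 = 6 :> R)%R//; ring.
  rewrite /ball_int [RHS]integral_mkcond; apply: eq_integral => y _.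
  rewrite /g /patch; case: ifP => // _.
  by rewrite abse0 poweR0r// gt_eqF.
rewrite -EFinM lee_fin.
apply: (@le_trans _ _ (2 `^ p * D * vol mu x r `^ (1 - p / q))%R); last first.
  rewrite ler_wpM2l//; first by rewrite mulr_ge0 ?powR_ge0// ltW.
  rewrite ge0_ler_powR ?nnegrE ?vol_ge0//; apply: le_vol => //; apply: sub_ball.
  rewrite mdistxx; lra.
have v0 := vol_gt0 radon x r0; rewrite le_eqVlt; apply/orP; left; apply/eqP.
rewrite /T -(mulrA 2%R) powRM ?mulr_ge0 ?powR_ge0// -[LHS]mulrA -[RHS]mulrA.
congr (_ * _)%R; rewrite -(lnK D0) -(lnK v0); move: (ln D) (ln _) => d w.
rewrite !powR_expR -!expRD powR_expR -!expRD; congr expR; field.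
by rewrite !gt_eqF.
Qed.

End maximal_morrey.
End morrey.

(** * The fractional maximal operator *)

Section fractional.
Context (R : realType) (X : pointedMetricType R).
Variable mu : {outer_measure set X -> \bar R}.
Hypothesis radon : radon_metric_measure mu.
Hypothesis doublingX : geometrically_doubling X.
Local Open Scope ereal_scope.

Let U := caratheodory_type mu.
Implicit Types (f : X -> \bar R) (x y : X) (r : R).

Lemma fractional_maximal_le_dilation (a b b' : R) f x : (a <= 1)%R ->
  (0 < b)%R -> (b <= b')%R ->
  fractional_maximal mu a b' f x <= fractional_maximal mu a b f x.
Proof.
move=> a1 b0 bb'; apply: ge_ereal_sup => _ [r /= r0 <-].
apply: (@le_trans _ _ (maximal_term mu a b f x r)); last first.
  by apply: ereal_sup_ubound; exists r.
rewrite -/(maximal_term mu a b' f x r) !maximal_termE// lee_wpmul2r//.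
  exact: integral_ge0.
rewrite lee_fin; apply: le_powR_vol => //; first by rewrite mulr_gt0.
by apply: sub_ball; rewrite mdistxx add0r ler_wpM2r// ltW.
Qed.

(** Each term of the fractional maximal function is a product of powers of the
    corresponding terms with exponents [1 / q - 1] and [- 1]; [ball_int_young]
    bounds the first, and the second is a term of the maximal function. *)
Lemma hedberg (b p q alpha D : R) f y : (1 < b)%R -> (1 < p)%R -> (0 < q)%R ->
  (0 < alpha)%R -> (alpha * q < 1)%R -> (0 < D)%R ->
  measurable_fun [set: U] f ->
  morrey_bounded mu b (1 - p / q) D (fun y => `|f y| `^ p) ->
  fractional_maximal mu alpha b f y <=
    ((2 * D `^ p^-1) `^ (alpha * q))%:E *
      fractional_maximal mu 0 b f y `^ (1 - alpha * q).
Proof.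
move=> b1 p1 q0 alpha0 aq1 D0 mf bf; apply: ge_ereal_sup => _ [r /= r0 <-].
have b0 : (0 < b)%R by apply: lt_trans b1.
have v0 : (0 < vol mu y (b * r))%R by rewrite vol_gt0// mulr_gt0.
have H0 : (0 <= 2 * D `^ p^-1)%R by rewrite mulr_ge0// powR_ge0.
have term_le : maximal_term mu 0 b f y r <= fractional_maximal mu 0 b f y.
  by apply: ereal_sup_ubound; exists r.
apply: (@le_trans _ _ (((2 * D `^ p^-1) `^ (alpha * q))%:E *
    maximal_term mu 0 b f y r `^ (1 - alpha * q))); last first.
  apply: lee_wpmul2l; first by rewrite lee_fin powR_ge0.
  apply: ge0_le_poweR => //; first by rewrite subr_ge0 ltW.
  by rewrite mule_ge0 ?poweR_ge0 ?integral_ge0.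
rewrite -/(maximal_term mu alpha b f y r) !maximal_termE//.
have := ball_int_young radon (ltW b1) p1 q0 D0 mf bf y r0.
have := ball_int_ge0 mu y r (fun z => abse_ge0 (f z)).
case: (ball_int _ _ _ _) => [u||//]; last by rewrite leye_eq.
move: (vol mu y (b * r)) v0 => v v0; rewrite !lee_fin le_eqVlt => /predU1P[<- _|u0 uH].
  by rewrite mulr0 mulr_ge0 ?powR_ge0.
have -> : (v `^ (alpha - 1) * u =
    (v `^ (q^-1 - 1) * u) `^ (alpha * q) *
    (v `^ (0 - 1) * u) `^ (1 - alpha * q))%R.
  rewrite -(lnK u0) -(lnK v0); move: (ln u) (ln v) => d w.
  rewrite !powR_expR -!expRD !powR_expR -!expRD; congr expR; field.
  by rewrite gt_eqF.
rewrite ler_wpM2r ?powR_ge0// ge0_ler_powR ?nnegrE//.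
- by rewrite mulr_ge0 ?ltW.
- by rewrite mulr_ge0 ?powR_ge0// ltW.
rewrite -(opprB 1%R q^-1) powRN mulrC ler_pdivrMr ?powR_gt0//.
Qed.

(** [hedberg] reduces the estimate to [maximal_morrey], with the dilation
    changed to [b] and 2 before it and from 6 back to [k] after it. The powers
    of [D] add up: [D^(alpha q / (1 - alpha q))] comes from the constant of
    [hedberg] and [D] from [maximal_morrey]. *)
Lemma fractional_morrey (p q alpha beta k : R) :
  (1 < p)%R -> (p <= q)%R -> (1 < beta)%R -> (0 < alpha)%R ->
  (alpha * q < 1)%R -> (1 < k)%R ->
  exists2 C : R, (0 < C)%R & forall f (D : R), (0 < D)%R ->
    measurable_fun [set: U] f ->
    morrey_bounded mu k (1 - p / q) D (fun y => `|f y| `^ p) ->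
    morrey_bounded mu k (1 - p / q) (C * D `^ (1 - alpha * q)^-1)
      (fun y => fractional_maximal mu alpha beta f y `^ (p / (1 - alpha * q))).
Proof.
move=> p1 pq beta1 alpha0 aq1 k1.
have p0 : (0 < p)%R by apply: lt_trans p1.
have q0 : (0 < q)%R by apply: lt_le_trans pq.
have s0 : (0 < 1 - alpha * q)%R by rewrite subr_gt0.
have a0 : (0 <= 1 - p / q)%R by rewrite subr_ge0 ler_pdivrMr// mul1r.
pose b : R := Num.min beta 2%R.
have b1 : (1 < b)%R by rewrite lt_min beta1 ltr1n.
have b2 : (b <= 2)%R by rewrite ge_min lexx orbT.
have bbeta : (b <= beta)%R by rewrite ge_min lexx.
have b0 : (0 < b)%R by apply: lt_trans b1.
have alpha1 : (alpha <= 1)%R.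
  by rewrite -(ler_pM2r q0) mul1r ltW// (lt_le_trans aq1)// ltW// (lt_le_trans p1).
have k0 : (0 < k)%R by apply: lt_trans k1.
have [N1 HN1] := morrey_bounded_dilation radon doublingX b1 k0 a0.
have one_lt2 : (1 < 2 :> R)%R by rewrite ltr1n.
have six0 : (0 < 6 :> R)%R by [].
have [N2 HN2] := morrey_bounded_dilation radon doublingX one_lt2 k0 a0.
have [N3 HN3] := morrey_bounded_dilation radon doublingX k1 six0 a0.
have [C C0 HC] := maximal_morrey radon doublingX b1 b2 p1 pq.
pose N : R := (N1 + N2).+1%:R.
have N0 : (0 < N)%R by rewrite ltr0n.
pose e := (alpha * q / (1 - alpha * q))%R.
have sp : (1 - alpha * q)%R != 0%R by rewrite gt_eqF.
exists (N3.+1%:R * ((2 * N `^ p^-1) `^ (p * e) * C * N))%R.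
  by rewrite !mulr_gt0// powR_gt0// mulr_gt0// powR_gt0.
move=> f D D0 mf bf.
have mfp : measurable_fun [set: U] (fun y => `|f y| `^ p).
  by apply: (measurableT_comp (measurable_poweR _)); exact: measurableT_comp.
have fp0 y : 0 <= `|f y| `^ p by exact: poweR_ge0.
have weaken (K : R) (n : nat) : (n <= (N1 + N2).+1)%N ->
    morrey_bounded mu K (1 - p / q) (n%:R * D) (fun y => `|f y| `^ p) ->
    morrey_bounded mu K (1 - p / q) (N * D) (fun y => `|f y| `^ p).
  move=> nN bd x r r0; apply: le_trans (bd x r r0) _.
  by rewrite lee_fin ler_wpM2r ?powR_ge0// ler_wpM2r ?(ltW D0)// ler_nat.
have bfb := weaken _ N1 (leq_trans (leq_addr _ _) (leqnSn _))
  (HN1 _ _ mfp fp0 (ltW D0) bf).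
have bf2 := weaken _ N2 (leq_trans (leq_addl _ _) (leqnSn _))
  (HN2 _ _ mfp fp0 (ltW D0) bf).
have ND0 : (0 < N * D)%R by rewrite mulr_gt0.
pose M := fractional_maximal mu 0 b f.
have M0 y : 0 <= M y by exact: fractional_maximal_ge0.
have Mp0 y : 0 <= M y `^ p by exact: poweR_ge0.
have mM : measurable_fun [set: U] (fun y => M y `^ p).
  apply: (measurableT_comp (measurable_poweR _)).
  exact: (measurable_fractional_maximal radon ler01 b0).
pose H : R := (2 * (N * D) `^ p^-1)%R.
have H0 : (0 < H)%R by rewrite mulr_gt0// powR_gt0.
have pt0 : (0 <= p / (1 - alpha * q))%R by rewrite divr_ge0 ?ltW.
have pointwise y : fractional_maximal mu alpha beta f y `^ (p / (1 - alpha * q))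
    <= (H `^ (p * e))%:E * M y `^ p.
  apply: (@le_trans _ _
      (((H `^ (alpha * q))%:E * M y `^ (1 - alpha * q)) `^ (p / (1 - alpha * q)))).
    apply: ge0_le_poweR => //; first exact: fractional_maximal_ge0.
    apply: le_trans (fractional_maximal_le_dilation f y alpha1 b0 bbeta) _.
    exact: hedberg.
  rewrite poweRM ?poweR_ge0 ?lee_fin ?powR_ge0// -poweRrM poweR_EFin -powRrM.
  rewrite (_ : alpha * q * _ = p * e)%R; last by rewrite /e; field.
  by rewrite (_ : (1 - alpha * q) * _ = p)%R//; field.
have mMa : measurable_fun [set: U]
    (fun y => fractional_maximal mu alpha beta f y `^ (p / (1 - alpha * q))).
  apply: (measurableT_comp (measurable_poweR _)).
  by apply: measurable_fractional_maximal => //; apply: lt_trans beta1.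
have Ma0 y : 0 <= fractional_maximal mu alpha beta f y `^ (p / (1 - alpha * q)).
  exact: poweR_ge0.
pose E : R := (H `^ (p * e) * (C * (N * D)))%R.
have E0 : (0 <= E)%R by rewrite !mulr_ge0 ?powR_ge0 ?ltW.
have bound6 : morrey_bounded mu 6 (1 - p / q) E
    (fun y => fractional_maximal mu alpha beta f y `^ (p / (1 - alpha * q))).
  move=> x r r0.
  apply: (@le_trans _ _ (ball_int mu (fun y => (H `^ (p * e))%:E * M y `^ p) x r)).
    by apply: le_ball_int => //; exact: measurable_funeM.
  rewrite /ball_int ge0_integralZl_EFin ?powR_ge0//.
  - rewrite /E -(mulrA (H `^ _)%R) EFinM lee_wpmul2l ?lee_fin ?powR_ge0//.
    exact: HC.
  - exact: measurable_metric_ball.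
  - exact: measurable_funTS.
move=> x r r0; apply: le_trans (HN3 _ _ mMa Ma0 E0 bound6 x r r0) _.
rewrite lee_fin ler_wpM2r ?powR_ge0//.
apply: (@le_trans _ _ (N3.+1%:R * E)%R).
  by rewrite ler_wpM2r// ler_nat.
rewrite -mulrA ler_wpM2l// le_eqVlt; apply/orP; left; apply/eqP.
rewrite /E /H (powRM p^-1 (ltW N0) (ltW D0)) (mulrA 2%R).
rewrite (powRM (p * e) (mulr_ge0 (ler0n R 2) (powR_ge0 N p^-1)) (powR_ge0 D p^-1)).
rewrite -(powRrM D) (_ : p^-1 * (p * e) = e)%R; last by field; rewrite gt_eqF.
have -> : (D `^ (1 - alpha * q)^-1 = D `^ e * D)%R.
  rewrite (_ : (1 - alpha * q)^-1 = e + 1)%R; last by rewrite /e; field.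
  by rewrite powRD ?powRr1 ?(ltW D0)//; apply/implyP => _; rewrite gt_eqF.
ring.
Qed.

End fractional.

Theorem proposition5p10 (R : realType) (X : pointedMetricType R)
    (mu : {outer_measure set X -> \bar R}) (p q alpha beta k : R) :
  geometrically_doubling X ->
  radon_metric_measure mu ->
  1 < p -> p <= q ->
  1 < beta ->
  0 < alpha -> alpha < q^-1 ->
  1 < k ->
  let pt := p / (1 - alpha * q) in
  let qt := q / (1 - alpha * q) in
  exists2 C : R, 0 < C &
    forall f : X -> \bar R, morrey_space mu k p q f ->
      morrey_space mu k pt qt (fractional_maximal mu alpha beta f) /\
      (morrey_norm mu k pt qt (fractional_maximal mu alpha beta f)
         <= C%:E * morrey_norm mu k p q f)%E.
Proof.
move=> doublingX radon p1 pq beta1 alpha0 alphaq k1 pt qt.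
have p0 : 0 < p by apply: lt_trans p1.
have q0 : 0 < q by apply: lt_le_trans pq.
have k0 : 0 < k by apply: lt_trans k1.
have beta0 : 0 < beta by apply: lt_trans beta1.
have aq1 : alpha * q < 1 by rewrite -ltr_pdivlMr// div1r.
have s0 : 0 < 1 - alpha * q by rewrite subr_gt0.
have pt0 : 0 < pt by rewrite divr_gt0.
have qt0 : 0 < qt by rewrite divr_gt0.
have ptqt : pt / qt = p / q by rewrite /pt /qt; field; rewrite !gt_eqF.
have alpha1 : alpha <= 1.
  by rewrite -(ler_pM2r q0) mul1r ltW// (lt_le_trans aq1)// ltW// (lt_le_trans p1).
have [C C0 HC] :=
  fractional_morrey radon doublingX p1 pq beta1 alpha0 aq1 k1.
have Cpt0 : 0 < C `^ pt^-1 by rewrite powR_gt0.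
exists (C `^ pt^-1) => // f [[mf floc] fnorm].
set n := morrey_norm mu k p q f in fnorm *.
have n0 : (0 <= n)%E.
  apply: le_trans (ereal_sup_ubound _); last by exists (point, 1); rewrite //= ltr01.
  by rewrite mule_ge0 ?poweR_ge0.
have nfin : n \is a fin_num by rewrite ge0_fin_numE.
have M0 y : (0 <= fractional_maximal mu alpha beta f y)%E.
  exact: fractional_maximal_ge0.
have Mabs : (fun y => `|fractional_maximal mu alpha beta f y| `^ pt)%E =
    (fun y => fractional_maximal mu alpha beta f y `^ pt)%E.
  by apply/funext => y; rewrite gee0_abs.
(* The estimates are used for real A > 0 above the norm, as the norm itself
   may vanish. *)
have bound (A : R) : 0 < A -> (n <= A%:E)%E ->
    morrey_bounded mu k (1 - pt / qt) ((C `^ pt^-1 * A) `^ pt)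
      (fun y => `|fractional_maximal mu alpha beta f y| `^ pt)%E.
  move=> A0 /(morrey_norm_leP radon _ k0 p0 q0 (ltW A0)) bf.
  rewrite Mabs ptqt powRM ?powR_ge0 ?(ltW A0)// -powRrM mulVf ?gt_eqF//.
  rewrite powRr1 ?(ltW C0)// /pt (powRrM A); apply: HC => //.
  exact: powR_gt0.
have norm_le (A : R) : 0 < A -> (n <= A%:E)%E ->
    (morrey_norm mu k pt qt (fractional_maximal mu alpha beta f)
       <= (C `^ pt^-1 * A)%:E)%E.
  move=> A0 nA; apply/morrey_norm_leP => //; first by rewrite mulr_ge0 ?ltW.
  exact: bound.
have n1 : (n <= (fine n + 1)%:E)%E by rewrite EFinD fineK// leeDl.
have n10 : 0 < fine n + 1 by rewrite ltr_wpDl// fine_ge0.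
split.
  split; last by apply: le_lt_trans (norm_le _ n10 n1) _; rewrite ltry.
  split; first exact: measurable_fractional_maximal.
  move=> x r r0; apply: le_lt_trans (bound _ n10 n1 x r r0) _.
  by rewrite ltry.
apply/lee_addgt0Pr => e e0.
have A0 : 0 < fine n + e / C `^ pt^-1 by rewrite ltr_wpDl ?fine_ge0// divr_gt0.
apply: le_trans (norm_le _ A0 _) _.
  by rewrite EFinD fineK// leeDl// lee_fin ltW// divr_gt0.
by rewrite mulrDr mulrCA mulfV ?gt_eqF// mulr1 EFinD EFinM fineK.
Qed.
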